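(* Let $A(\Gamma)$ be an ear RAAG with underlying graph $\Gamma\neq C_4$, where $C_4$ is the cycle on $4$ vertices. Let $x\in A(\Gamma)$ be an element and $y,z\in A(\Gamma)$ adjacent inner pearls such that $C(y)=\langle x,y,z\rangle$ and such that $A(\Gamma)/\langle\langle y\rangle\rangle$ splits as a free product with one factor being $\mathbb{Z}$. Then there is a vertex basis of $A(\Gamma)$ containing $x$, $y$ and $z$ such that $x$ arises from a degree $1$ vertex in $\Gamma$, $y$ from its adjacent vertex and $z$ from the degree $2$ vertex adjacent to the vertex from which $y$ arises.
   Context: All graphs are finite, undirected and simple. The right-angled Artin group (RAAG) with underlying graph $\Gamma$ is $A(\Gamma)=\langle v\in V(\Gamma)\mid [v,w]=1\text{ whenever }\{v,w\}\in E(\Gamma)\rangle$. An ear is a graph that is a path or a cycle, with more than one vertex; an ear RAAG is a RAAG whose underlying graph is an ear. $C(y)$ is the centralizer of $y$ and $\langle\langle y\rangle\rangle$ its normal closure. A vertex basis of $A(\Gamma)$ is a generating set as in the presentation $\langle v\in V(\Gamma)\mid [v,w]=1\text{ whenever }\{v,w\}\in E(\Gamma)\rangle$, i.e. the image $\varphi(V(\Gamma))$ of the standard generators under an automorphism $\varphi$ of $A(\Gamma)$; the element $\varphi(v)$ is said to arise from the vertex $v$. An inner pearl here is a nontrivial element with non-abelian centralizer that generates the center of its centralizer. Inner pearls $x,y$ are adjacent if $[x,y]=1$ and there is $z\in A(\Gamma)$ with $[x,z]=1$ and $[y,z]\neq 1$. *)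

(* Defs.v *)
From HB Require Import structures.
From mathcomp Require Import all_boot all_algebra.
From mathcomp Require Import boolp classical_sets.

Set Implicit Arguments.
Unset Strict Implicit.
Unset Printing Implicit Defensive.

Local Open Scope classical_set_scope.
Local Open Scope quotient_scope.
Local Open Scope group_scope.

(** * Subgroups of a possibly infinite group *)

Section Subgroups.
Variable G : groupType.
Implicit Types (S : set G) (x y : G).

Definition is_subgroup S : Prop :=
  [/\ S 1, forall x y, S x -> S y -> S (x * y) & forall x, S x -> S x^-1].

Definition is_normal_subgroup S : Prop :=
  is_subgroup S /\ forall x y, S x -> S (x ^ y).

Definition generated S : set G := smallest is_subgroup S.

Definition normal_closure S : set G := smallest is_normal_subgroup S.

Definition centralizer x : set G := [set y | commute x y].

Definition center S : set G :=
  [set x | S x /\ forall y, S y -> commute x y].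

Definition is_abelian S : Prop := forall x y, S x -> S y -> commute x y.

Lemma normal_closure_normal S : is_normal_subgroup (normal_closure S).
Proof.
split; first split.
- by move=> N [[[N1 _ _] _] _].
- move=> x y Sx Sy N NS; have [[[_ NM _] _] _] := NS.
  by apply: NM; [apply: Sx | apply: Sy].
- by move=> x Sx N NS; have [[[_ _ NV] _] _] := NS; apply: NV; apply: Sx.
- by move=> x y Sx N NS; have [[_ NJ] _] := NS; apply: NJ; apply: Sx.
Qed.

End Subgroups.

Definition isomorphic (G H : groupType) : Prop :=
  exists f : {multiplicative G -> H}, bijective f.

(** * The quotient [G / <<S>>] *)

Section Quotient.
Variables (G : groupType) (S : set G).

Let N := normal_closure S.

Definition quot_rel : rel G := fun x y => `[< normal_closure S (x^-1 * y) >].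

Let N1 : N 1. Proof. by have [[]] := normal_closure_normal S. Qed.
Let NM x y : N x -> N y -> N (x * y).
Proof. by have [[_ NM _] _] := normal_closure_normal S; apply: NM. Qed.
Let NV x : N x -> N x^-1.
Proof. by have [[_ _ NV] _] := normal_closure_normal S; apply: NV. Qed.
Let NJ x y : N x -> N (x ^ y).
Proof. by have [_ NJ] := normal_closure_normal S; apply: NJ. Qed.

Fact quot_rel_refl : reflexive quot_rel.
Proof. by move=> x; apply/asboolP; rewrite mulVg. Qed.

Fact quot_rel_sym : symmetric quot_rel.
Proof.
have sub x y : quot_rel x y -> quot_rel y x.
  by move=> /asboolP/NV; rewrite invgM invgK => ?; apply/asboolP.
by move=> x y; apply/idP/idP; apply: sub.
Qed.

Fact quot_rel_trans : transitive quot_rel.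
Proof.
move=> y x z /asboolP Nxy /asboolP Nyz; apply/asboolP.
by have := NM Nxy Nyz; rewrite mulgA mulgK.
Qed.

Canonical quot_equiv := EquivRel quot_rel quot_rel_refl quot_rel_sym
  quot_rel_trans.

Definition quot : Type := {eq_quot quot_equiv}.
HB.instance Definition _ := Choice.on quot.
HB.instance Definition _ := EqQuotient.on quot.

Definition quot_proj (x : G) : quot := \pi_quot x.

Definition quot_one : quot := quot_proj 1.
Definition quot_mul (a b : quot) : quot := quot_proj (repr a * repr b).
Definition quot_inv (a : quot) : quot := quot_proj (repr a)^-1.

Lemma quot_projP x y :
  quot_proj x = quot_proj y <-> normal_closure S (x^-1 * y).
Proof.
split=> [/(@eqmodP _ quot_equiv)/asboolP //|Nxy].
by apply/(@eqmodP _ quot_equiv)/asboolP.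
Qed.

Lemma quot_projK a : quot_proj (repr a) = a. Proof. exact: reprK. Qed.

Lemma quot_projM x y : quot_mul (quot_proj x) (quot_proj y) = quot_proj (x * y).
Proof.
apply/quot_projP; set x' := repr _; set y' := repr _.
have Nx : N (x'^-1 * x) by apply/quot_projP; rewrite quot_projK.
have Ny : N (y'^-1 * y) by apply/quot_projP; rewrite quot_projK.
have := NM (NJ y' Nx) Ny.
by rewrite /conjg invgM !mulgA mulgK.
Qed.

Lemma quot_projV x : quot_inv (quot_proj x) = quot_proj x^-1.
Proof.
apply/quot_projP; set x' := repr _.
have Nx : N (x^-1 * x') by apply/quot_projP; rewrite quot_projK.
by have := NJ x^-1 Nx; rewrite /conjg !mulgA !invgK mulgV mul1g; apply.
Qed.

Fact quot_mulA : associative quot_mul.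
Proof.
move=> a b c; rewrite -(quot_projK a) -(quot_projK b) -(quot_projK c).
by rewrite !quot_projM mulgA.
Qed.
Fact quot_mul1 : left_id quot_one quot_mul.
Proof. by move=> a; rewrite -(quot_projK a) quot_projM mul1g. Qed.
Fact quot_mulr1 : right_id quot_one quot_mul.
Proof. by move=> a; rewrite -(quot_projK a) quot_projM mulg1. Qed.
Fact quot_mulV : left_inverse quot_one quot_inv quot_mul.
Proof. by move=> a; rewrite -(quot_projK a) quot_projV quot_projM mulVg. Qed.
Fact quot_mulrV : right_inverse quot_one quot_inv quot_mul.
Proof. by move=> a; rewrite -(quot_projK a) quot_projV quot_projM mulgV. Qed.

HB.instance Definition _ :=
  isGroup.Build quot quot_mulA quot_mul1 quot_mulr1 quot_mulV quot_mulrV.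

End Quotient.

(** * Free groups: words in the letters [(x, true)], read [x], and
    [(x, false)], read [x^-1], modulo insertion of cancelling pairs *)

Section FreeGroup.
Variable X : choiceType.

Definition word : Type := seq (X * bool).
HB.instance Definition _ := Choice.on word.

Definition letter_inv (l : X * bool) : X * bool := (l.1, ~~ l.2).

Definition word_inv (u : word) : word := rev (map letter_inv u).

Inductive free_eq : word -> word -> Prop :=
| free_eq_refl u : free_eq u u
| free_eq_sym u v : free_eq u v -> free_eq v u
| free_eq_trans u v w : free_eq u v -> free_eq v w -> free_eq u w
| free_eq_cancel u v l : free_eq (u ++ [:: l; letter_inv l] ++ v) (u ++ v).

Definition free_rel : rel word := fun u v => `[< free_eq u v >].

Fact free_rel_refl : reflexive free_rel.
Proof. by move=> u; apply/asboolP/free_eq_refl. Qed.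
Fact free_rel_sym : symmetric free_rel.
Proof.
by move=> u v; apply/idP/idP=> /asboolP uv; apply/asboolP/free_eq_sym.
Qed.
Fact free_rel_trans : transitive free_rel.
Proof.
by move=> v u w /asboolP uv /asboolP vw; apply/asboolP/(free_eq_trans uv).
Qed.

Canonical free_equiv := EquivRel free_rel free_rel_refl free_rel_sym
  free_rel_trans.

Definition free_group : Type := {eq_quot free_equiv}.
HB.instance Definition _ := Choice.on free_group.
HB.instance Definition _ := EqQuotient.on free_group.

Definition free_word (u : word) : free_group := \pi_free_group u.

Definition free_gen (x : X) : free_group := free_word [:: (x, true)].

Definition free_one : free_group := free_word [::].
Definition free_mul (a b : free_group) : free_group :=
  free_word (repr a ++ repr b).
Definition free_inv (a : free_group) : free_group :=
  free_word (word_inv (repr a)).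

Lemma free_wordP u v : free_word u = free_word v <-> free_eq u v.
Proof.
split=> [/(@eqmodP _ free_equiv)/asboolP //|uv].
by apply/(@eqmodP _ free_equiv)/asboolP.
Qed.

Lemma free_wordK a : free_word (repr a) = a. Proof. exact: reprK. Qed.

Lemma free_eq_cat u u' v v' :
  free_eq u u' -> free_eq v v' -> free_eq (u ++ v) (u' ++ v').
Proof.
move=> uu' vv'; apply: (@free_eq_trans _ (u' ++ v)).
  elim: uu' => {u u'} [u|u w _|u w t _ uw _|u w l].
  - exact: free_eq_refl.
  - exact: free_eq_sym.
  - exact: free_eq_trans uw.
  - by rewrite -!catA; apply: free_eq_cancel.
elim: vv' => {v v'} [v|v w _|v w t _ vw _|v w l].
- exact: free_eq_refl.
- exact: free_eq_sym.
- exact: free_eq_trans vw.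
- by rewrite !(catA u'); apply: free_eq_cancel.
Qed.

Lemma letter_invK : involutive letter_inv.
Proof. by case=> x b; rewrite /letter_inv negbK. Qed.

Lemma word_invK : involutive word_inv.
Proof.
by move=> u; rewrite /word_inv map_rev revK mapK //; apply: letter_invK.
Qed.

Lemma free_eq_invr u : free_eq (u ++ word_inv u) [::].
Proof.
elim: u => [|l u IHu]; first exact: free_eq_refl.
rewrite /word_inv map_cons rev_cons -cats1 -/(word_inv u).
apply: free_eq_trans (free_eq_cancel [::] [::] l).
rewrite -cat1s -catA (catA u).
apply: (free_eq_cat (free_eq_refl [:: l])).
exact: (free_eq_cat IHu (free_eq_refl [:: letter_inv l])).
Qed.

Lemma free_eq_invl u : free_eq (word_inv u ++ u) [::].
Proof. by rewrite -{2}(word_invK u); apply: free_eq_invr. Qed.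

Lemma free_wordM u v :
  free_mul (free_word u) (free_word v) = free_word (u ++ v).
Proof.
by apply/free_wordP/free_eq_cat; apply/free_wordP; rewrite free_wordK.
Qed.

Fact free_mulA : associative free_mul.
Proof.
move=> a b c; rewrite -(free_wordK a) -(free_wordK b) -(free_wordK c).
by rewrite !free_wordM catA.
Qed.
Fact free_mul1 : left_id free_one free_mul.
Proof. by move=> a; rewrite -(free_wordK a) free_wordM. Qed.
Fact free_mulr1 : right_id free_one free_mul.
Proof. by move=> a; rewrite -(free_wordK a) free_wordM cats0. Qed.
Fact free_mulV : left_inverse free_one free_inv free_mul.
Proof.
move=> a; rewrite -{2}(free_wordK a) free_wordM.
by apply/free_wordP/free_eq_invl.
Qed.
Fact free_mulrV : right_inverse free_one free_inv free_mul.
Proof.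
move=> a; rewrite -{1}(free_wordK a) free_wordM.
by apply/free_wordP/free_eq_invr.
Qed.

HB.instance Definition _ :=
  isGroup.Build free_group free_mulA free_mul1 free_mulr1 free_mulV free_mulrV.

End FreeGroup.

(** * Presentations [<X | R>], free products *)

Definition presented (X : choiceType) (R : set (free_group X)) : groupType :=
  quot R.

Definition presented_gen (X : choiceType) (R : set (free_group X)) (x : X) :
  presented R := quot_proj R (free_gen x).

(* [H * K] is presented by the elements of [H] and of [K], subject to the two
   multiplication tables. *)
Inductive free_product_relator (H K : groupType) :
    free_group (H + K)%type -> Prop :=
| free_product_relator_l (a b : H) : free_product_relator
    (free_gen (inl a) * free_gen (inl b) / free_gen (inl (a * b)))
| free_product_relator_r (a b : K) : free_product_relator
    (free_gen (inr a) * free_gen (inr b) / free_gen (inr (a * b))).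

Definition free_product (H K : groupType) : groupType :=
  presented (@free_product_relator H K).

(* [Algebra.to_multiplicative int] is the additive group of the integers,
   written multiplicatively. *)
Definition splits_off_Z (G : groupType) : Prop :=
  exists H : groupType,
    isomorphic G (free_product H (Algebra.to_multiplicative int)).

(** * Graphs *)

Definition graph_iso (V W : finType) (e : rel V) (e' : rel W) : Prop :=
  exists2 f : V -> W, bijective f & forall u v, e' (f u) (f v) = e u v.

Definition path_graph (n : nat) : rel 'I_n :=
  fun i j => (i.+1 == j :> nat) || (j.+1 == i :> nat).

(* This is the [n]-cycle for [2 < n] only. *)
Definition cycle_graph (n : nat) : rel 'I_n :=
  fun i j => (i.+1 %% n == j :> nat) || (j.+1 %% n == i :> nat).

Definition is_ear (V : finType) (e : rel V) : Prop :=
  (exists2 n, 1 < n & graph_iso e (@path_graph n)) \/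
  (exists2 n, 2 < n & graph_iso e (@cycle_graph n)).

Definition degree (V : finType) (e : rel V) (v : V) : nat :=
  #|[pred u | e v u]|.

(** * Right-angled Artin groups *)

Definition raag_relators (V : finType) (e : rel V) : set (free_group V) :=
  [set r | exists v w, e v w /\ r = [~ free_gen v, free_gen w]].

Definition raag (V : finType) (e : rel V) : groupType :=
  presented (raag_relators e).

Definition raag_gen (V : finType) (e : rel V) (v : V) : raag e :=
  presented_gen (raag_relators e) v.

(* The vertex basis is the image of [b]; [b v] arises from the vertex [v]. *)
Definition vertex_basis (V : finType) (e : rel V) (b : V -> raag e) : Prop :=
  exists2 phi : {multiplicative raag e -> raag e},
    bijective phi & forall v, b v = phi (raag_gen e v).

(** * Pearls *)

Definition inner_pearl (G : groupType) (x : G) : Prop :=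
  [/\ x <> 1, ~ is_abelian (centralizer x)
    & center (centralizer x) = generated [set x]].

Definition adjacent_pearls (G : groupType) (x y : G) : Prop :=
  [~ x, y] = 1 /\ exists z : G, [~ x, z] = 1 /\ [~ y, z] <> 1.

(* Main.v *)
(* An element of a right-angled Artin group is determined by its columns: the
   column of [v] lists the letters of a reduced word that do not commute with
   [v], recording the sign of the letters of [v] and a blank for the others.
   If [y] is cyclically reduced with support [S] and [h] commutes with [y], then
   [h y^n = y^n h] agrees with [y^n] near both ends of its columns.  Hence [h] is
   the product of an element over [S] and of an element over the link of [S],
   and the elements over [S] that arise commute with each other.  So if the centralizer of [y] is not abelian,
   the link contains two nonadjacent vertices; as the graph has no square, [S]
   is a single vertex, and an inner pearl is a conjugate of a vertex or of its
   inverse.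

   After a conjugation, [y] and [z] come from adjacent vertices [v] and [w].  The
   neighbours of [v] are [w] and some [b], and the centralizer of [v] is
   [<v> * F(w, b)], so that [x = v^k f] where [f] and [w] generate [F(w, b)];
   counting the letters of [b] in words in [f] and [w] shows that
   [f = w^i b^(+-1) w^j].  Finally, the splitting of the quotient by [y] forces
   some vertex other than [v] to have no neighbour but [v]: otherwise there would
   be too few homomorphisms from it to the affine group of [F_3].  This vertex is
   [b], and [b |-> v^k w^i b^(+-1) w^j] extends to an automorphism. *)

Require Import Defs.
From HB Require Import structures.
From mathcomp Require Import all_boot all_algebra perm.
From mathcomp Require Import boolp classical_sets zify.

Set Implicit Arguments.
Unset Strict Implicit.
Unset Printing Implicit Defensive.

Local Open Scope classical_set_scope.

(** * Maps that respect multiplication *)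

Section Morphisms.
Variables (G H : groupType) (f : G -> H).
Local Open Scope group_scope.
Hypothesis fM : {morph f : x y / x * y}.

Lemma morph1 : f 1 = 1.
Proof. by apply: (@mulgI _ (f 1)); rewrite -fM !mulg1. Qed.

Lemma morphV : {morph f : x / x^-1}.
Proof. by move=> x; apply: (@mulgI _ (f x)); rewrite -fM !mulgV morph1. Qed.

Lemma morphJ : {morph f : x y / x ^ y}.
Proof. by move=> x y; rewrite /conjg !fM morphV. Qed.

Lemma morphR : {morph f : x y / [~ x, y]}.
Proof. by move=> x y; rewrite /commg fM morphV morphJ. Qed.

Lemma morphX n : {morph f : x / x ^+ n}.
Proof. by move=> x; elim: n => [|n IH]; rewrite ?morph1 // !expgS fM IH. Qed.

Lemma morph_commute x y : commute x y -> commute (f x) (f y).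
Proof. by rewrite /commute -!fM => ->. Qed.

End Morphisms.

Lemma quot_proj_morph (G : groupType) (S : set G) :
  {morph quot_proj S : x y / (x * y)%g}.
Proof. by move=> x y; apply: esym; apply: quot_projM. Qed.

(** * Words and piles *)

Section Columns.
Variables (V : finType) (e : rel V).
Hypotheses (e_sym : symmetric e) (e_irr : irreflexive e).
Implicit Types (u v : V) (l : V * bool) (w : word V).

(** The case [u = v] is included so that the column of [u] shows the cancellations between letters
    of [u]. *)
Definition blocks u v := (u == v) || ~~ e u v.

Lemma blocksC u v : blocks u v = blocks v u.
Proof. by rewrite /blocks eq_sym e_sym. Qed.

Lemma blocks_refl u : blocks u u. Proof. by rewrite /blocks eqxx. Qed.

Lemma blocksN u v : ~~ blocks u v = e u v.
Proof.
rewrite /blocks negb_or negbK; case: eqP => //= ->.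
by rewrite e_irr.
Qed.

Definition entry u l : option bool := if l.1 == u then Some l.2 else None.

Definition column u w : seq (option bool) :=
  [seq entry u l | l <- w & blocks u l.1].

Lemma column_cat u w1 w2 : column u (w1 ++ w2) = column u w1 ++ column u w2.
Proof. by rewrite /column filter_cat map_cat. Qed.

Lemma column_cons u l w :
  column u (l :: w) = if blocks u l.1 then entry u l :: column u w else column u w.
Proof. by rewrite /column /=; case: ifP. Qed.

Definition pile := V -> seq (option bool).

(** Left multiplication by [l] on the piles of reduced words. If the inverse of [l] is on top of its
    own column, it is also on top of every other column where it left a blank, and all these entries
    are removed. *)
Definition push l (p : pile) : pile :=
  if ohead (p l.1) == Some (Some (~~ l.2))
  then fun u => if blocks u l.1 then behead (p u) else p u
  else fun u => if blocks u l.1 then entry u l :: p u else p u.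

(** Letters outside the column of [l] commute with [l], so [l] can cancel only against the first
    later letter of its own column. *)
Fixpoint reduced w :=
  if w is l :: w' then
    (ohead (column l.1 w') != Some (Some (~~ l.2))) && reduced w'
  else true.

Lemma column_headP v s w : ohead (column v w) = Some (Some s) ->
  exists w1 w2, w = w1 ++ (v, s) :: w2 /\ all (fun l => e v l.1) w1.
Proof.
elim: w => // -[u t] w IHw; rewrite column_cons /=.
case: ifPn => [|]; last first.
  rewrite blocksN => evu /IHw[w1 [w2 [-> aw1]]].
  by exists ((u, t) :: w1), w2; rewrite /= evu.
by rewrite /entry /=; case: eqP => [->|//] _ [->]; exists [::], w.
Qed.

Lemma column_comm v w : all (fun l => e v l.1) w -> column v w = [::].
Proof.
elim: w => //= l w IHw /andP[evl aw]; rewrite column_cons IHw //.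
by rewrite -blocksN in evl; rewrite (negPf evl).
Qed.

Lemma column_commN v u w : all (fun l => e v l.1) w -> blocks u v -> u != v ->
  column u w = nseq (size (column u w)) None.
Proof.
move=> aw buv neq; elim: w aw => //= l w IHw /andP[evl aw].
rewrite column_cons; case: ifP => //= _; rewrite -IHw // /entry.
case: eqP evl => // -> evu; move: buv; rewrite blocksC.
by rewrite -blocksN in evu; rewrite (negPf evu).
Qed.

(** If [u] differs from [v] and blocks it, then [w1] and [(v, s)] leave only blanks in the column of
    [u], so that removing the blank of [(v, s)] amounts to removing the first one. *)
Lemma column_del v s w1 w2 u : all (fun l => e v l.1) w1 ->
  column u (w1 ++ w2) =
    let c := column u (w1 ++ (v, s) :: w2) in
    if blocks u v then behead c else c.
Proof.
move=> aw; rewrite !column_cat column_cons /=; case: (boolP (blocks u v)) => // buv.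
case: (eqVneq u v) => [->|neq]; first by rewrite (column_comm aw).
rewrite /entry /= eq_sym (negPf neq) (column_commN aw) //.
by case: (size _) => //= k; elim: k => //= k <-.
Qed.

Lemma reduced_catl w1 w2 : reduced (w1 ++ w2) -> reduced w1.
Proof.
elim: w1 => //= l w1 IH /andP[h1 /IH ->]; rewrite andbT.
by move: h1; rewrite column_cat; case: (column _ w1).
Qed.

Lemma reduced_catr w1 w2 : reduced (w1 ++ w2) -> reduced w2.
Proof. by elim: w1 => //= l w1 IH /andP[_ /IH]. Qed.

Lemma reduced_del v s w1 w2 : all (fun l => e v l.1) w1 ->
  reduced (w1 ++ (v, s) :: w2) -> reduced (w1 ++ w2).
Proof.
elim: w1 => [_ /andP[]//|l w1 IH] /= /andP[evl aw1] /andP[h /(IH aw1) ->].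
rewrite andbT (column_del s _ _ aw1) /=; move: evl.
by rewrite e_sym -blocksN => /negPf ->.
Qed.

(** On these piles pushing a letter undoes pushing its inverse; this fails for arbitrary families of
    sequences. *)
Definition valid (p : pile) := exists2 w, reduced w & p = column^~ w.

Lemma valid_nil : valid (fun=> [::]). Proof. by exists [::]. Qed.

Lemma push_reduced l w : reduced (l :: w) ->
  push l (column^~ w) = column^~ (l :: w).
Proof.
move=> /= /andP[/negPf h _]; rewrite /push h; apply: funext => u.
by rewrite column_cons.
Qed.

Lemma valid_push l p : valid p -> valid (push l p).
Proof.
move=> [w rw ->]; case: (boolP (reduced (l :: w))) => [rlw|].
  by exists (l :: w) => //; rewrite push_reduced.
rewrite /= rw andbT negbK => /eqP h.
have [w1 [w2 [def_w aw1]]] := column_headP h.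
exists (w1 ++ w2); first by move: rw; rewrite def_w; apply: reduced_del.
rewrite /push h eqxx; apply: funext => u.
by rewrite (column_del (~~ l.2) _ _ aw1) -def_w.
Qed.

Lemma valid_top p v s u : valid p -> ohead (p v) = Some (Some s) ->
  blocks u v -> u != v -> ohead (p u) = Some None.
Proof.
move=> [w rw ->] /column_headP[w1 [w2 [-> aw1]]] buv neq.
rewrite column_cat column_cons buv /entry /= eq_sym (negPf neq).
by rewrite (column_commN aw1) //; case: (size _).
Qed.

Lemma valid_behead p v s : valid p -> ohead (p v) = Some (Some s) ->
  ohead (behead (p v)) != Some (Some (~~ s)).
Proof.
move=> [w rw ->] /column_headP[w1 [w2 [def_w aw1]]]; move: rw; rewrite def_w.
rewrite column_cat column_cons column_comm // blocks_refl /=.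
by move/reduced_catr => /= /andP[].
Qed.

(** The deleted entries are those that the other push inserts: by [valid_top] the tops of the other
    blocked columns are blanks, and by [valid_behead] no second cancellation occurs. *)
Lemma pushK l p : valid p -> push l (push (letter_inv l) p) = p.
Proof.
case: l => v s vp; rewrite /letter_inv /push /= negbK.
case: (p v =P p v) => // _.
case: (ohead (p v) =P Some (Some s)) => h.
  rewrite blocks_refl (negPf (valid_behead vp h)); apply: funext => u.
  case: (boolP (blocks u v)) => // buv; rewrite /entry /=.
  case: (eqVneq v u) => [<-|neq].
    by case: (p v) h => //= a q [->].
  have := valid_top vp h buv; rewrite eq_sym neq => /(_ isT).
  by case: (p u) => //= a q [->].
rewrite blocks_refl /= /entry /= !eqxx; apply: funext => u.
by case: (blocks u v).
Qed.

(** Neither letter changes the column of the other; in a column that both change, each inserts or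
    deletes a blank at the top. *)
Lemma pushC l m p : e l.1 m.1 -> valid p -> push l (push m p) = push m (push l p).
Proof.
move=> elm vp; have nlm : blocks l.1 m.1 = false.
  by apply/negbTE; rewrite blocksN.
have nml : blocks m.1 l.1 = false by rewrite blocksC.
have hm : push m p l.1 = p l.1 by rewrite /push; case: ifP => _; rewrite nlm.
have hl : push l p m.1 = p m.1 by rewrite /push; case: ifP => _; rewrite nml.
rewrite [LHS]/push [RHS]/push hm hl /push.
have neqs u : blocks u l.1 -> blocks u m.1 -> u != l.1 /\ u != m.1.
  move=> bl bm; split; apply/eqP => eu; first by rewrite eu nlm in bm.
  by rewrite eu nml in bl.
case: (ohead (p l.1) =P _) => tl; case: (ohead (p m.1) =P _) => tm;
  apply: funext => u;
  case: (boolP (blocks u l.1)) => // bl; case: (boolP (blocks u m.1)) => // bm;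
  have [nl nm] := neqs u bl bm.
- have := valid_top vp tl bl nl; rewrite /entry ![_.1 == u]eq_sym (negPf nm).
  by case: (p u) => //= a q [->].
- have := valid_top vp tm bm nm; rewrite /entry ![_.1 == u]eq_sym (negPf nl).
  by case: (p u) => //= a q [->].
- by rewrite /entry ![_.1 == u]eq_sym (negPf nl) (negPf nm).
Qed.

Definition act w (p : pile) := foldr push p w.

Lemma valid_act w p : valid p -> valid (act w p).
Proof. by move=> vp; elim: w => //= l w; apply: valid_push. Qed.

Lemma act_cat w1 w2 p : act (w1 ++ w2) p = act w1 (act w2 p).
Proof. by rewrite /act foldr_cat. Qed.

Lemma act_free_eq w w' p : free_eq w w' -> valid p -> act w p = act w' p.
Proof.
move=> eqw; elim: eqw p => {w w'} [w|w w' _ IH|w w' w'' _ IH1 _ IH2|w w' l] p vp //.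
- by rewrite IH.
- by rewrite IH1 // IH2.
rewrite (act_cat w w') (act_cat w) (act_cat [:: l; letter_inv l]) /=.
by rewrite pushK //; apply: valid_act.
Qed.

Lemma act_inv w p : valid p -> act (word_inv w) (act w p) = p.
Proof. by move=> vp; rewrite -act_cat (act_free_eq (free_eq_invl w)). Qed.

Lemma act_reduced w : reduced w -> act w (fun=> [::]) = column^~ w.
Proof.
elim: w => //= l w IH rlw; have /andP[_ rw] := rlw.
by rewrite IH // push_reduced.
Qed.

Lemma free_word_cat (w1 w2 : word V) :
  free_word (w1 ++ w2) = (free_word w1 * free_word w2)%g.
Proof. by rewrite -free_wordM. Qed.

Lemma free_wordV (w : word V) : ((free_word w)^-1)%g = free_word (word_inv w).
Proof.
apply: (@mulgI _ (free_word w)); rewrite mulgV; apply: esym.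
apply: etrans (free_wordM _ _) _; exact/free_wordP/free_eq_invr.
Qed.

Definition elt w : raag e := quot_proj (raag_relators e) (free_word w).

Lemma elt_cat w1 w2 : elt (w1 ++ w2) = (elt w1 * elt w2)%g.
Proof. by rewrite /elt -free_wordM -quot_projM. Qed.

Lemma elt_nil : elt [::] = 1%g. Proof. by []. Qed.

Lemma eltV w : elt (word_inv w) = (elt w)^-1%g.
Proof.
apply: (@mulgI _ (elt w)); rewrite mulgV -elt_cat /elt.
by have /free_wordP -> := free_eq_invr w.
Qed.

Lemma elt_surj (g : raag e) : exists w, g = elt w.
Proof. by exists (repr (repr g)); rewrite /elt free_wordK quot_projK. Qed.

(** The elements of the free group that act trivially on valid piles form a normal subgroup, which
    contains the relators by [pushC]. *)
Lemma act_elt w w' p : elt w = elt w' -> valid p -> act w p = act w' p.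
Proof.
pose N : set (free_group V) := [set a | forall p, valid p -> act (repr a) p = p].
have actM (a b : free_group V) q : valid q ->
    act (repr (a * b)%g) q = act (repr a) (act (repr b) q).
  move=> vq; rewrite -act_cat; apply: act_free_eq => //.
  by apply/free_wordP; rewrite free_wordK -free_wordM !free_wordK.
have actV (a : free_group V) q : valid q ->
    act (repr (a^-1)%g) q = act (word_inv (repr a)) q.
  by move=> vq; apply: act_free_eq => //; apply/free_wordP; rewrite free_wordK.
have actw w1 q : valid q -> act (repr (free_word w1)) q = act w1 q.
  by move=> vq; apply: act_free_eq => //; apply/free_wordP; rewrite free_wordK.
have N1 : N 1%g by move=> q vq; rewrite actw.
have NM a b : N a -> N b -> N (a * b)%g.
  by move=> Na Nb q vq; rewrite actM // Nb // Na.
have NV a : N a -> N (a^-1)%g.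
  by move=> Na q vq; rewrite actV // -{1}(Na q vq) act_inv.
have NN : is_normal_subgroup N.
  split; first by split.
  move=> a b Na q vq; rewrite /conjg actM // (actM a) // Na; last exact: valid_act.
  by rewrite actV ?act_inv //; apply: valid_act.
have RN : raag_relators e `<=` N.
  move=> _ [v [v' [evv' ->]]] q vq.
  have -> : [~ free_gen v, free_gen v']%g =
      free_word [:: (v, false); (v', false); (v, true); (v', true)].
    rewrite /commg /conjg !free_wordV /free_gen.
    rewrite (_ : [:: _, _, _ & _] = [:: (v, false)] ++ ([:: (v', false)] ++
      ([:: (v, true)] ++ [:: (v', true)]))) // !free_word_cat; reflexivity.
  rewrite actw //= (@pushC (v, true) (v', true)) //.
  by rewrite (@pushK (v', false)) ?(@pushK (v, false)) //; apply: valid_push.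
move=> eqww' vp.
have /(_ N (conj NN RN)) /(_ p vp) : normal_closure (raag_relators e)
    ((free_word w)^-1 * free_word w')%g by apply/quot_projP.
rewrite free_wordV actM // !actw //; last exact: valid_act.
by move=> h; rewrite -{1}h -act_cat (act_free_eq (free_eq_invr w)) //; apply: valid_act.
Qed.
End Columns.

(** * Columns as normal forms of group elements *)

Section ReducedWords.
Variables (V : finType) (e : rel V).
Hypotheses (e_sym : symmetric e) (e_irr : irreflexive e).
Implicit Types (u v : V) (l : V * bool) (w : word V) (g h : raag e).
Local Open Scope group_scope.

Local Notation elt := (elt e).
Local Notation column := (column e).
Local Notation reduced := (reduced e).
Local Notation blocks := (blocks e).
Local Notation act := (act e).
Local Notation valid := (valid e).

Lemma elt_cons l w : elt (l :: w) = elt [:: l] * elt w.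
Proof. by rewrite -elt_cat. Qed.

Lemma elt_gen v : elt [:: (v, true)] = raag_gen e v. Proof. by []. Qed.

Lemma elt_letterV l : elt [:: letter_inv l] = (elt [:: l])^-1.
Proof. by rewrite -eltV. Qed.

Lemma raag_gen_comm u v : e u v -> commute (raag_gen e u) (raag_gen e v).
Proof.
move=> euv; apply/commgP/eqP.
have : normal_closure (raag_relators e) [~ free_gen u, free_gen v].
  by move=> N [_ NR]; apply: NR; exists u, v.
rewrite -[X in normal_closure _ X]mul1g -invg1 => /quot_projP h.
rewrite (_ : 1 = quot_proj (raag_relators e) 1) // h.
exact: esym (morphR (@quot_proj_morph _ (raag_relators e)) _ _).
Qed.

Lemma elt_letter_comm l m : e l.1 m.1 -> commute (elt [:: l]) (elt [:: m]).
Proof.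
have genE k : elt [:: k] = if k.2 then raag_gen e k.1 else (raag_gen e k.1)^-1.
  by case: k => v []; rewrite -?elt_letterV.
move/raag_gen_comm => c; rewrite !genE.
have cV (G : groupType) (a b : G) : commute a b -> commute a^-1 b.
  by move=> ab; apply: commute_sym; apply: commuteV; apply: commute_sym.
by case: l.2; case: m.2 => //; do ?[apply: cV | apply: commuteV].
Qed.

Lemma elt_word_comm l w : all (fun m => e l.1 m.1) w ->
  commute (elt [:: l]) (elt w).
Proof.
elim: w => [_|m w IHw] /=; first exact: commute1.
by move=> /andP[elm /IHw c]; rewrite (elt_cons m); apply: commuteM => //;
   apply: elt_letter_comm.
Qed.

(** The last two clauses record that reducing enlarges no support and shortens every word that it
    changes. *)
Lemma reduce_word w :
  exists w', [/\ reduced w', elt w' = elt w, {subset w' <= w} &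
    (w' == w) || (size w' < size w)%N].
Proof.
elim: w => [|l w [w' [rw' eww' sww' szw]]]; first by exists [::].
have sub x : x \in w' -> x \in l :: w by rewrite inE => /sww' ->; rewrite orbT.
case: (boolP (reduced (l :: w'))) => [rlw'|].
  exists (l :: w'); split=> //.
  - by rewrite elt_cons eww' -elt_cons.
  - by move=> x; rewrite !inE => /orP[-> //|/sww' ->]; rewrite orbT.
  - by case/orP: szw => [/eqP ->|szw] /=; rewrite ?eqxx // ltnS szw orbT.
rewrite /= rw' andbT negbK => /eqP /column_headP.
move/(_ e_irr) => [w1 [w2 [def_w' aw1]]].
have szww' : (size w' <= size w)%N by case/orP: szw => [/eqP ->|/ltnW].
exists (w1 ++ w2); split.
- by move: rw'; rewrite def_w'; apply: reduced_del.
- rewrite elt_cons -eww' def_w' !elt_cat (elt_cons _ w2) mulgA.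
  have -> : elt [:: l] * elt w1 = elt w1 * elt [:: l] by apply: elt_word_comm.
  have -> : (l.1, ~~ l.2) = letter_inv l by [].
  by rewrite elt_letterV -!mulgA mulVKg.
- move=> x; rewrite mem_cat => xw; apply: sub; rewrite def_w' mem_cat inE.
  by case/orP: xw => ->; rewrite ?orbT.
- apply/orP; right; move: szww'; rewrite def_w' !size_cat /= addnS.
  by move/ltn_trans; apply.
Qed.

Lemma elt_reduced g : exists2 w, reduced w & g = elt w.
Proof.
have [w ->] := elt_surj g; have [w' [rw' <- _ _]] := reduce_word w.
by exists w'.
Qed.

(** Words for the same element act alike on the empty pile, and a reduced word takes it to its own
    columns. *)
Lemma reduced_column w w' u : reduced w -> reduced w' -> elt w = elt w' ->
  column u w = column u w'.
Proof.
move=> rw rw' eww'; have := act_elt e_sym e_irr eww' (valid_nil e).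
by rewrite !act_reduced // => /(congr1 (@^~ u)).
Qed.

(** Each letter leaves one signed entry, in the column of its own vertex, and only blanks
    elsewhere. *)
Lemma size_column w : size w = \sum_v count isSome (column v w).
Proof.
elim: w => [|l w IHw]; first by rewrite big1.
transitivity (\sum_v ((v == l.1) + count isSome (column v w))%N).
  rewrite big_split /= -IHw (bigD1 l.1) //= eqxx big1 // => v.
  by move/negPf ->.
apply: eq_bigr => v _; rewrite column_cons /entry eq_sym.
by case: eqP => [<-|_]; rewrite ?blocks_refl //=; case: ifP.
Qed.

Lemma reduced_size w w' : reduced w -> reduced w' -> elt w = elt w' ->
  size w = size w'.
Proof.
move=> rw rw' eww'; rewrite !size_column; apply: eq_bigr => v _.
by rewrite (reduced_column v rw rw').
Qed.

Lemma reducedP w :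
  reduced w <-> forall w', elt w' = elt w -> (size w <= size w')%N.
Proof.
split=> [rw w' eww'|minw].
  have [w1 [rw1 ew1 _ /orP sz]] := reduce_word w'.
  rewrite (@reduced_size w w1) ?ew1 //.
  by case: sz => [/eqP ->|/ltnW].
have [w1 [rw1 ew1 _ /orP[/eqP <- //|]]] := reduce_word w.
by rewrite ltnNge minw.
Qed.

Lemma size_word_inv w : size (word_inv w) = size w.
Proof. by rewrite size_rev size_map. Qed.

Lemma reduced_inv w : reduced w -> reduced (word_inv w).
Proof.
move/reducedP => minw; apply/reducedP => w' ew'.
rewrite size_word_inv -(size_word_inv w'); apply: minw.
by rewrite eltV ew' eltV invgK.
Qed.

Lemma column_inv u w :
  column u (word_inv w) = rev (map (omap negb) (column u w)).
Proof.
rewrite /column /word_inv filter_rev map_rev; congr rev.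
rewrite filter_map -!map_comp; apply: eq_map => l /=.
by rewrite /entry /=; case: ifP.
Qed.

(* The pile of an arbitrary word for [g] is its image of the empty pile, and
   it is the family of columns of any reduced word for [g]. *)
Definition col u g := act (repr (repr g)) (fun=> [::]) u.

Lemma col_elt_act w : col^~ (elt w) = act w (fun=> [::]).
Proof.
rewrite /col; apply: (act_elt e_sym e_irr _ (valid_nil e)).
by rewrite /elt free_wordK quot_projK.
Qed.

Lemma col_elt w u : reduced w -> col u (elt w) = column u w.
Proof.
by move=> rw; have /(congr1 (@^~ u)) := col_elt_act w; rewrite act_reduced.
Qed.

Lemma col1 u : col u 1 = [::].
Proof. by rewrite -(elt_nil e) col_elt. Qed.

Lemma col_act w g : col^~ (elt w * g) = act w (col^~ g).
Proof.
by have [w' ->] := elt_surj g; rewrite -elt_cat !col_elt_act act_cat.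
Qed.

Lemma colV u g : col u g^-1 = rev (map (omap negb) (col u g)).
Proof.
have [w rw ->] := elt_reduced g.
by rewrite -eltV !col_elt ?column_inv //; apply: reduced_inv.
Qed.

(** A cancellation between [w1] and [w2] would show at the junction of some column. *)
Lemma reduced_cat w1 w2 : reduced w1 -> reduced w2 ->
    (forall v s, last None (column v w1) = Some s ->
                 head None (column v w2) <> Some (~~ s)) ->
  reduced (w1 ++ w2).
Proof.
elim: w1 => //= l w1 IH /andP[h rw1] rw2 junction.
apply/andP; split; last first.
  apply: IH => // v s; move: (junction v s); rewrite column_cons.
  by case: ifP => // _; case: (column v w1).
apply/eqP; rewrite column_cat; move: h; move: (junction l.1 l.2).
rewrite column_cons blocks_refl /entry eqxx.
case: (column l.1 w1) => [|a c] /=; last by move=> _ /eqP.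
by move=> /(_ erefl); case: (column _ w2) => //= a c h _ [ha]; apply: h.
Qed.

Lemma colM g h :
    (forall v s, last None (col v g) = Some s ->
                 head None (col v h) <> Some (~~ s)) ->
  forall v, col v (g * h) = col v g ++ col v h.
Proof.
have [w rw ->] := elt_reduced g; have [w' rw' ->] := elt_reduced h.
move=> junction v; rewrite -elt_cat !col_elt ?column_cat //.
by apply: reduced_cat => // u s; rewrite -!col_elt //; apply: junction.
Qed.

End ReducedWords.

(** * Centralizers in right-angled Artin groups *)

Section Shared.
Variable T : Type.
Implicit Types (X Y r a : seq T).

(** This is how columns compare before and after left multiplication by a word of length at most
    [M]. *)
Definition same_tail M X Y :=
  exists a b r, [/\ X = a ++ r, Y = b ++ r, size a <= M & size b <= M].

Definition same_head M X Y :=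
  exists a b r, [/\ X = r ++ a, Y = r ++ b, size a <= M & size b <= M].

Lemma same_tail_head M X Y : same_tail M (rev X) (rev Y) -> same_head M X Y.
Proof.
case=> a [b [r [hX hY ha hb]]]; exists (rev a), (rev b), (rev r).
by rewrite !size_rev -!rev_cat -hX -hY !revK.
Qed.

Lemma same_head_take M X Y K : same_head M X Y -> K + M <= size X ->
  take K Y = take K X.
Proof.
case=> a [b [r [-> -> ha hb]]]; rewrite size_cat => h.
have hK : K <= size r by rewrite -(leq_add2r M) (leq_trans h) ?leq_add2l.
by rewrite !takel_cat.
Qed.

Lemma same_head_size M X Y : same_head M X Y -> size Y <= size X + M.
Proof.
case=> a [b [r [-> -> ha hb]]]; rewrite !size_cat -addnA leq_add2l.
by rewrite (leq_trans hb) ?leq_addl.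
Qed.

Lemma same_tail_drop M X Y K : same_tail M X Y -> K + M <= size X ->
  drop (size Y - K) Y = drop (size X - K) X.
Proof.
case=> a [b [r [-> -> ha hb]]]; rewrite size_cat addnC => h.
have hK : K <= size r by rewrite -(leq_add2l M) (leq_trans h) ?leq_add2r.
rewrite size_cat -!addnBA // !drop_cat !ltnNge !leq_addr /=.
by rewrite !addKn.
Qed.

Lemma same_ends_eq M X Y Y' :
    same_head M X Y -> same_tail M X Y -> same_head M X Y' -> same_tail M X Y' ->
  size Y = size Y' -> 3 * M <= size X -> Y = Y'.
Proof.
move=> hY tY hY' tY' eqs leM.
have szY := same_head_size hY.
(* The [K] entries at either end of [Y] are prescribed by [X], and they cover [Y] because
   [size Y <= size X + M <= 2 * K]. *)
pose K := size X - M; have hK : K + M <= size X by lia.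
have leK : size Y - K <= K by lia.
rewrite -(cat_take_drop K Y) -(cat_take_drop K Y').
have dropE Z : size Z = size Y ->
    drop K Z = drop (K - (size Z - K)) (drop (size Z - K) Z).
  by move=> szZ; rewrite drop_drop; congr drop; lia.
rewrite (same_head_take hY hK) (same_head_take hY' hK) !dropE //.
by rewrite (same_tail_drop tY hK) (same_tail_drop tY' hK) eqs.
Qed.

Lemma same_ends_all P M X Y : same_head M X Y -> same_tail M X Y ->
  3 * M <= size X -> all P X -> all P Y.
Proof.
move=> hY tY leM PX; have szY := same_head_size hY.
pose K := size X - M; have hK : K + M <= size X by lia.
have leK : size Y - K <= K by lia.
rewrite -(cat_take_drop K Y) all_cat (same_head_take hY hK).
have -> : drop K Y = drop (K - (size Y - K)) (drop (size Y - K) Y).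
  by rewrite drop_drop; congr drop; lia.
rewrite (same_tail_drop tY hK).
have all_drop n Z : all P Z -> all P (drop n Z).
  by rewrite -{1}(cat_take_drop n Z) all_cat => /andP[].
rewrite !all_drop // andbT.
by move: PX; rewrite -{1}(cat_take_drop K X) all_cat => /andP[].
Qed.

End Shared.

(** * Columns of products, supports and cyclic reduction *)

Section Centralizers.
Variables (V : finType) (e : rel V).
Hypotheses (e_sym : symmetric e) (e_irr : irreflexive e).
Implicit Types (u v : V) (l : V * bool) (w : word V) (g h y : raag e).
Implicit Types (S : pred V).
Local Open Scope group_scope.

Local Notation elt := (elt e).
Local Notation column := (column e).
Local Notation reduced := (reduced e).
Local Notation blocks := (blocks e).
Local Notation act := (act e).

(** Each letter inserts or deletes at most one entry, at the top of a column. *)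
Lemma same_tail_act w (p : pile V) u : same_tail (size w) (p u) (act w p u).
Proof.
elim: w => [|l w [a [b [r [hX hY ha hb]]]]] /=; first by exists [::], [::], (p u).
rewrite {1}/push; case: ifP => _; case: ifP => _; rewrite {}hX {}hY.
- case: b hb => [|x b] hb; last by exists a, b, r; split=> //; move: ha hb => /=; lia.
  case: r => [|x r]; first by exists a, [::], [::]; split=> //; apply: leqW.
  by exists (rcons a x), [::], r; rewrite cat_rcons size_rcons.
- by exists a, b, r; split=> //; apply: leqW.
- by exists a, (entry u l :: b), r; split=> //; apply: leqW.
- by exists a, b, r; split=> //; apply: leqW.
Qed.

Lemma same_tail_col w g u : same_tail (size w) (col u g) (col u (elt w * g)).
Proof.
have := same_tail_act w (fun u => col u g) u.
by rewrite -(congr1 (@^~ u) (col_act e_sym e_irr w g)).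
Qed.

(** This is left multiplication seen through inverses, whose columns are reversed. *)
Lemma same_head_col w g u : same_head (size w) (col u g) (col u (g * elt w)).
Proof.
have [a [b [r [hX hY ha hb]]]] := same_tail_col (word_inv w) g^-1 u.
apply: same_tail_head; exists (map (omap negb) a), (map (omap negb) b),
  (map (omap negb) r).
rewrite !size_map -!map_cat -hX -hY -(size_word_inv w) eltV -invgM !colV //.
rewrite !map_rev; split=> //; congr rev; rewrite -map_comp map_id_in //.
  by move=> [[]|].
by move=> [[]|].
Qed.

(** Whether a letter cancels depends only on the top of its own column. Hence a word over [S] makes
    the same choices on two piles that agree to sufficient depth over [S], and changes the lengths
    of their columns equally. *)
Lemma act_agree S w (p p' : pile V) m : all (fun l => S l.1) w -> (size w <= m)%N ->
    (forall b, S b -> take m (p b) = take m (p' b)) ->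
  forall b, S b -> take (m - size w) (act w p b) = take (m - size w) (act w p' b)
    /\ (size (act w p b) + size (p' b) = size (act w p' b) + size (p b))%N.
Proof.
move=> Sw szw agree; elim: w Sw szw => [|l w IH] /=.
  by move=> _ _ b Sb; rewrite subn0 agree // addnC.
move=> /andP[Sl Sw] szw b Sb; have {}IH := IH Sw (ltnW szw).
have [k def_k] : exists k, (m - size w = k.+1)%N.
  by exists (m - (size w).+1)%N; rewrite subnSK.
rewrite subnS def_k /= in IH *.
have head_eq c : S c -> ohead (act w p c) = ohead (act w p' c).
  by case/IH; case: (act w p c) (act w p' c) => [|x q] [|x' q'] //= [->].
have [Eb szb] := IH b Sb.
rewrite /push head_eq //; case: ifP => _; case: ifP => _.
- have szb' : (size (act w p b) == 0) = (size (act w p' b) == 0).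
    by move: (head_eq b Sb); case: (act w p b) (act w p' b) => [|x q] [|x' q'].
  split; last by rewrite !size_behead; lia.
  by case: (act w p b) (act w p' b) Eb => [|x q] [|x' q'] //= [].
- by split=> //; move: Eb => /(congr1 (take k)); rewrite !take_takel.
- split; last by rewrite /=; lia.
  move: Eb => /(congr1 (take k)); rewrite !take_takel //.
  by case: k {def_k IH} => //= k /(congr1 (take k)); rewrite !take_takel // => ->.
- by split=> //; move: Eb => /(congr1 (take k)); rewrite !take_takel.
Qed.

Definition supported S g := exists2 w, all (fun l => S l.1) w & g = elt w.

Lemma supported1 S : supported S 1. Proof. by exists [::]. Qed.

Lemma supportedM S g h : supported S g -> supported S h -> supported S (g * h).
Proof.
move=> [w Sw ->] [w' Sw' ->]; exists (w ++ w'); last by rewrite elt_cat.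
by rewrite all_cat Sw.
Qed.

Lemma supportedV S g : supported S g -> supported S g^-1.
Proof.
move=> [w Sw ->]; exists (word_inv w); last by rewrite eltV.
by rewrite all_rev all_map.
Qed.

Lemma supportedX S g n : supported S g -> supported S (g ^+ n).
Proof.
move=> Sg; elim: n => [|n IH]; first exact: supported1.
by rewrite expgS; apply: supportedM.
Qed.

Lemma supported_gen S v : S v -> supported S (raag_gen e v).
Proof. by move=> Sv; exists [:: (v, true)] => //=; rewrite Sv. Qed.

Lemma supported_sub S S' g : (forall v, S v -> S' v) -> supported S g ->
  supported S' g.
Proof.
move=> sub [w Sw ->]; exists w => //.
by apply: sub_all Sw => l; apply: sub.
Qed.

Lemma supportedP S g :
  supported S g <-> forall u, ~~ S u -> all (fun a => a == None) (col u g).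
Proof.
split=> [[w Sw ->] u Su | h].
  have [w' [rw' <- sub _]] := reduce_word e_sym e_irr w.
  rewrite col_elt // /Defs.word; apply/allP => a /mapP[l].
  rewrite mem_filter => /andP[_ /sub lw] ->.
  rewrite /entry; case: (l.1 =P u) => // lu.
  by have /allP/(_ l lw) := Sw; rewrite lu (negPf Su).
have [w rw def_g] := elt_reduced e_sym e_irr g.
exists w => //; apply/allP => l lw; apply/negPn/negP => Sl.
have /allP/(_ (Some l.2)) := h _ Sl; suff -> : Some l.2 \in col l.1 g by move=> /(_ isT).
rewrite def_g col_elt //; apply/mapP; exists l; last by rewrite /entry eqxx.
by rewrite mem_filter lw blocks_refl.
Qed.

(** The letters of a reduced word for [g] are removed from both elements one at a time; the effect
    on the columns over [S] is decided by these columns alone. *)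
Lemma supported_eq S g h : supported S g -> supported S h ->
  (forall b, S b -> col b g = col b h) -> g = h.
Proof.
have [w rw ->] := elt_reduced e_sym e_irr g.
elim: w rw h => [|l w IH] rlw h Sg Sh eqgh.
  have [w' rw' def_h] := elt_reduced e_sym e_irr h; rewrite def_h.
  case: w' rw' def_h => // l w' rw' def_h; have Sl : S l.1.
    apply/negPn/negP => /(proj1 (supportedP S h) Sh l.1).
    by rewrite def_h col_elt // column_cons blocks_refl /entry eqxx.
  have := eqgh _ Sl; rewrite def_h !col_elt // column_cons blocks_refl.
  by rewrite /entry.
have rw : reduced w by case/andP: rlw.
have Sl : S l.1.
  apply/negPn/negP => /(proj1 (supportedP S _) Sg l.1).
  by rewrite col_elt // column_cons blocks_refl /entry eqxx.
have Sl1 : supported S (elt [:: letter_inv l]).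
  by exists [:: letter_inv l]; rewrite //= Sl.
rewrite elt_cons (IH rw (elt [:: letter_inv l] * h)); first last.
- move=> b Sb; have -> : elt w = elt [:: letter_inv l] * elt (l :: w).
    by rewrite (elt_cons _ l) elt_letterV mulKg.
  have colE k : col b (elt [:: letter_inv l] * k)
      = push e (letter_inv l) (fun u => col u k) b.
    by have /(congr1 (@^~ b)) := col_act e_sym e_irr [:: letter_inv l] k.
  by rewrite !colE /push (eqgh l.1) //; case: ifP => _; rewrite eqgh.
- exact: supportedM.
- rewrite -[elt w](mulKg (elt [:: l])) -elt_cons -elt_letterV.
  exact: supportedM.
by rewrite elt_letterV mulVKg.
Qed.

(** No column has ends that cancel against each other, so that the columns of a power are
    repetitions of those of [y]. *)
Definition cyclically_reduced y :=
  forall v s, last None (col v y) = Some s -> head None (col v y) <> Some (~~ s).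

Lemma col_expg y n v : cyclically_reduced y ->
  col v (y ^+ n) = flatten (nseq n (col v y)).
Proof.
move=> cry; elim: n v => [|n IH] v; first by rewrite expg0 col1.
rewrite expgS colM ?IH // => u s hl; rewrite IH.
case: n {IH} => [|n] /=; first by [].
by case: (col u y) (cry u s hl) (hl).
Qed.

Lemma size_col_expg y n v : cyclically_reduced y -> col v y != [::] ->
  (n <= size (col v (y ^+ n)))%N.
Proof.
move=> cry ne; rewrite col_expg // size_flatten /shape map_nseq sumn_nseq.
by rewrite leq_pmull // lt0n size_eq0.
Qed.

Lemma elt_top v s w1 w2 : all (fun l => e v l.1) w1 ->
  elt (w1 ++ (v, s) :: w2) = elt [:: (v, s)] * elt (w1 ++ w2).
Proof.
move=> aw1; rewrite !elt_cat (elt_cons _ _ w2) !mulgA; congr (_ * _).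
by apply: esym; apply: elt_word_comm.
Qed.

(** Induction on the length: if the column of [v] begins and ends with opposite letters of [v],
    these are moved to the two ends of the word. The length does not change, so the new word is
    reduced too. *)
Lemma cyclic_decomposition w : reduced w -> exists ws wc,
  [/\ reduced (ws ++ wc ++ word_inv ws), elt (ws ++ wc ++ word_inv ws) = elt w
    & cyclically_reduced (elt wc)].
Proof.
have [n] := ubnP (size w); elim: n w => // n IH w /ltnSE szw rw.
case: (pselect (cyclically_reduced (elt w))) => [cr|].
  by exists [::], w; rewrite cats0.
move/existsNP => [v /existsNP[s /not_implyP[hl /contrapT hh]]].
move: hl hh; rewrite !col_elt // => hl hh.
have /(column_headP e_irr)[w1 [w2 [def_w aw1]]] :
    ohead (column v w) = Some (Some (~~ s)).
  by case: (column v w) hh => //= a c ->.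
have rw12 : reduced (w1 ++ w2).
  by move: rw; rewrite def_w; apply: reduced_del.
(* The two letters have opposite signs and so are distinct: the last one survives the removal of the
   first, and is located in the inverse word. *)
have : ohead (column v (word_inv (w1 ++ w2))) = Some (Some (~~ s)).
  rewrite column_inv (column_del _ _ (~~ s) _ _ aw1) // blocks_refl -def_w.
  move: hl hh; case: (column v w) => [|a [|b c]] //=; first by move=> ->; case; case: (s).
  by move=> h _; rewrite -[_ :: _]/(map (omap negb) (b :: c)) -map_rev lastI
    rev_rcons /= h.
move/(column_headP e_irr) => [w3 [w4 [def_w12 aw3]]].
have rw34 : reduced (w3 ++ w4).
  apply: (@reduced_del _ e e_sym e_irr v (~~ s)) => //.
  by rewrite -def_w12; apply: reduced_inv.
pose w' := word_inv (w3 ++ w4); have rw' : reduced w' by apply: reduced_inv.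
have sz : size w = (size w').+2.
  have := congr1 size def_w12; rewrite size_word_inv def_w /w' size_word_inv.
  by rewrite !size_cat /=; lia.
have ew : elt w = elt [:: (v, ~~ s)] * elt w' * elt [:: (v, s)].
  rewrite def_w elt_top // -mulgA; congr (_ * _).
  apply: invg_inj; rewrite -eltV def_w12 elt_top // invgM -elt_letterV.
  by rewrite /w' eltV invgK.
have szw' : (size w' < n)%N by lia.
have [ws [wc [rwc ewc cr]]] := IH w' szw' rw'.
have word_invE : word_inv ((v, ~~ s) :: ws) = word_inv ws ++ [:: (v, s)].
  by rewrite /word_inv /= rev_cons -cats1 /letter_inv /= negbK.
have ew' : elt (((v, ~~ s) :: ws) ++ wc ++ word_inv ((v, ~~ s) :: ws)) = elt w.
  rewrite ew -ewc word_invE cat_cons (elt_cons _ _ (ws ++ _)) !elt_cat.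
  by rewrite !mulgA.
exists ((v, ~~ s) :: ws), wc; split=> //.
apply/(reducedP e_sym e_irr) => w5 ew5.
have <- : size w = size (((v, ~~ s) :: ws) ++ wc ++ word_inv ((v, ~~ s) :: ws)).
  rewrite sz (reduced_size e_sym e_irr rw' rwc) // word_invE.
  by rewrite /= !size_cat /=; lia.
by move/(reducedP e_sym e_irr): rw; apply; rewrite ew5.
Qed.

End Centralizers.

(** * Centralizers of cyclically reduced elements *)

Section CentralizerTheorem.
Variables (V : finType) (e : rel V).
Hypotheses (e_sym : symmetric e) (e_irr : irreflexive e).
Implicit Types (u v : V) (l : V * bool) (w : word V) (g h k y : raag e).
Implicit Types (S L : pred V).
Local Open Scope group_scope.

Local Notation elt := (elt e).

Definition support g : pred V := fun v => has isSome (col v g).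

Definition link S : pred V := fun v => [forall u, S u ==> e v u].

Lemma supported_support g : supported (support g) g.
Proof.
apply/supportedP => // u; rewrite /support -all_predC.
by apply: sub_all => -[].
Qed.

Lemma col_neq_nil g u v : support g v -> blocks e u v -> col u g != [::].
Proof.
have [w rw ->] := elt_reduced e_sym e_irr g; rewrite /support col_elt //.
case/hasP=> a /mapP[l]; rewrite mem_filter => /andP[_ lw] ->.
rewrite /entry; case: eqP => // <- _ buv; rewrite col_elt //.
apply/eqP => /(congr1 size); rewrite size_map size_filter => /eqP.
rewrite -leqn0 leqNgt -has_count => /hasP; apply.
by exists l.
Qed.

Lemma supported_commute S L g h : (forall u v, S u -> L v -> e u v) ->
  supported S g -> supported L h -> commute g h.
Proof.
move=> SL [w Sw ->] [w' Lw' ->]; elim: w Sw => [|l w IH] /=.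
  by move=> _; apply: commute_sym; apply: commute1.
move=> /andP[Sl Sw]; rewrite elt_cons; apply: commute_sym; apply: commuteM.
  apply: commute_sym; apply: elt_word_comm.
  by apply: sub_all Lw' => m; apply: SL.
by apply: commute_sym; apply: IH.
Qed.

Lemma supported_join S L g : (forall u v, S u -> L v -> e u v) ->
    supported (fun v => S v || L v) g ->
  exists g1 g2, [/\ g = g1 * g2, supported S g1 & supported L g2].
Proof.
move=> SL [w]; elim: w g => [|l w IH] g /=.
  by move=> _ ->; exists 1, 1; rewrite elt_nil mulg1; split; do ?apply: supported1.
move=> /andP[SLl SLw] ->; have [g1 [g2 [eg Sg1 Lg2]]] := IH _ SLw erefl.
rewrite elt_cons eg.
case/orP: SLl => [Sl|Ll].
  exists (elt [:: l] * g1), g2; split=> //; first by rewrite mulgA.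
  by apply: supportedM => //; exists [:: l]; rewrite //= Sl.
have Ll1 : supported L (elt [:: l]) by exists [:: l]; rewrite //= Ll.
exists g1, (elt [:: l] * g2); split=> //; last exact: supportedM.
by rewrite !mulgA (supported_commute SL Sg1 Ll1).
Qed.

(** For [u] outside the support and the link, the column of [u] in [y] is a nonempty sequence of
    blanks. As [h y^n = y^n h] agrees with [y^n] near both ends of the column, it has only blanks
    there as well. *)
Lemma centralizer_supported y h : cyclically_reduced y -> commute y h ->
  supported (fun v => support y v || link (support y) v) h.
Proof.
move=> cry yh; have [w def_h] := elt_surj h.
(* The factor 3 makes the two ends that [h] leaves unchanged overlap. *)
pose n := (3 * size w)%N; have ynh : commute (y ^+ n) h.
  by apply: commute_sym; apply: commuteX; apply: commute_sym.
suff : supported (fun v => support y v || link (support y) v) (h * y ^+ n).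
  have Sy : supported (fun v => support y v || link (support y) v) (y ^+ n).
    apply: supportedX; apply: supported_sub (supported_support y).
    by move=> v ->.
  by move=> hS; rewrite -(mulgK (y ^+ n) h); apply: supportedM => //; apply: supportedV.
apply/supportedP => // u; rewrite negb_or => /andP[Su].
rewrite negb_forall => /existsP[v]; rewrite negb_imply => /andP[Sv neuv].
have ne : col u y != [::] by apply: col_neq_nil Sv _; rewrite /blocks neuv orbT.
apply: (@same_ends_all _ _ (size w) (col u (y ^+ n))).
- by rewrite -ynh def_h; apply: same_head_col.
- by rewrite def_h; apply: same_tail_col.
- exact: size_col_expg.
have := supportedX n (supported_support y).
by move/(supportedP e_sym e_irr) => /(_ u Su).
Qed.

(* Both [h k y^n] and [k h y^n] agree with [y^n] near the two ends of every
   column of the support; multiplying by [h] changes the length of a column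
   in the same way whether it acts on [y^n] or on [k y^n = y^n k], so that
   these columns also have the same length. *)
Lemma centralizer_support_abelian y h k : cyclically_reduced y ->
    commute y h -> commute y k ->
    supported (support y) h -> supported (support y) k ->
  commute h k.
Proof.
move=> cry yh yk Sh Sk; have [wh Swh def_h] := Sh; have [wk Swk def_k] := Sk.
pose M := (size wh + size wk)%N; pose n := (3 * M)%N.
have ynC g : commute y g -> commute (y ^+ n) g.
  by move=> yg; apply: commute_sym; apply: commuteX; apply: commute_sym.
have szn b : support y b -> (n <= size (col b (y ^+ n)))%N.
  move=> Sb; apply: size_col_expg => //; apply: col_neq_nil Sb _.
  exact: blocks_refl.
have size_act w w' b : all (fun l => support y l.1) w ->
    (size w + size w' = M)%N -> commute y (elt w') -> support y b ->
    (size (col b (elt w * (elt w' * y ^+ n))) + size (col b (y ^+ n)) =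
    size (col b (elt w * y ^+ n)) + size (col b (elt w' * y ^+ n)))%N.
  move=> Sw szM yw' Sb.
  have colE g : col b (elt w * g) = act e w (fun u => col u g) b.
    by have /(congr1 (@^~ b)) := col_act e_sym e_irr w g.
  rewrite !colE.
  have /(_ _ b Sb)[|//] := @act_agree _ e (support y) w
    (fun u => col u (elt w' * y ^+ n)) (fun u => col u (y ^+ n)) _ Sw (leqnn _).
  move=> c Sc.
  apply: (@same_head_take _ (size w')); last first.
    by have := szn _ Sc; rewrite /n; lia.
  by rewrite -ynC //; apply: same_head_col.
have eqn : h * k * y ^+ n = k * h * y ^+ n.
  have yhk : commute y (h * k) by apply: commuteM.
  have ykh : commute y (k * h) by apply: commuteM.
  apply: (supported_eq e_sym e_irr (S := support y)).
  - by do ?apply: supportedM => //; apply: supportedX; apply: supported_support.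
  - by do ?apply: supportedM => //; apply: supportedX; apply: supported_support.
  move=> b Sb; apply: (@same_ends_eq _ M (col b (y ^+ n))).
  - rewrite -ynC // def_h def_k -elt_cat /M -size_cat; exact: same_head_col.
  - rewrite def_h def_k -elt_cat /M -size_cat; exact: same_tail_col.
  - rewrite -ynC // def_h def_k -elt_cat /M addnC -size_cat; exact: same_head_col.
  - rewrite def_h def_k -elt_cat /M addnC -size_cat; exact: same_tail_col.
  - have := size_act wh wk b Swh erefl; have := size_act wk wh b Swk (addnC _ _).
    rewrite -def_h -def_k -!mulgA => /(_ yh Sb) e1 /(_ yk Sb) e2.
    by apply/eqP; rewrite -(eqn_add2r (size (col b (y ^+ n)))) e2 e1 addnC.
  exact: szn.
exact: mulIg eqn.
Qed.

Lemma centralizer_decomposition y h : cyclically_reduced y -> commute y h ->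
  exists h1 h2, [/\ h = h1 * h2, supported (support y) h1,
    supported (link (support y)) h2 & commute y h1].
Proof.
move=> cry yh; have SL u v : support y u -> link (support y) v -> e u v.
  by move=> Su /forallP/(_ u)/implyP/(_ Su); rewrite e_sym.
have [h1 [h2 [def_h Sh1 Lh2]]] := supported_join SL (centralizer_supported cry yh).
exists h1, h2; split=> //; have -> : h1 = h * h2^-1 by rewrite def_h mulgK.
apply: commuteM => //; apply: commuteV.
exact: supported_commute SL (supported_support y) Lh2.
Qed.

Lemma supported_clique_abelian S g h :
    (forall u v, S u -> S v -> u != v -> e u v) ->
  supported S g -> supported S h -> commute g h.
Proof.
move=> clq [w Sw ->] Sh; elim: w Sw => [|l w IH] /=.
  by move=> _; apply: commute_sym; apply: commute1.
move=> /andP[Sl Sw]; rewrite elt_cons; apply: commute_sym.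
apply: commuteM; last by apply: commute_sym; apply: IH.
case: Sh => w' Sw' ->; apply: commute_sym.
elim: w' Sw' => [_|m w' IH'] /=; first exact: commute1.
move=> /andP[Sm Sw']; rewrite (elt_cons _ m); apply: commuteM; last exact: IH'.
case: (eqVneq l.1 m.1) => [|nlm]; last first.
  by apply: elt_letter_comm => //; apply: clq.
case: l m {Sl Sm IH IH'} => [v s] [v' s'] /= <-.
have c t : commute (elt [:: (v, t)]) (elt [:: (v, ~~ t)]).
  by rewrite -[(v, ~~ t)]/(letter_inv (v, t)) elt_letterV; apply: commuteV.
by case: s s' => [] [] //.
Qed.

(** If the link were a clique, both kinds of factors in [centralizer_decomposition] would commute
    among themselves and with each other. *)
Lemma centralizer_nonabelian y : cyclically_reduced y ->
    ~ is_abelian (centralizer y) ->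
  exists a b, [/\ link (support y) a, link (support y) b, a != b & ~~ e a b].
Proof.
move=> cry nab; apply: contrapT => nlink; apply: nab => h k yh yk.
have clq u v : link (support y) u -> link (support y) v -> u != v -> e u v.
  move=> Lu Lv uv; apply/negPn/negP => neuv; apply: nlink; exists u, v.
  by split.
have [h1 [h2 [-> Sh1 Lh2 yh1]]] := centralizer_decomposition cry yh.
have [k1 [k2 [-> Sk1 Lk2 yk1]]] := centralizer_decomposition cry yk.
have SL u v : support y u -> link (support y) v -> e u v.
  by move=> Su /forallP/(_ u)/implyP/(_ Su); rewrite e_sym.
apply: commuteM; apply: commute_sym; apply: commuteM.
- exact: (centralizer_support_abelian cry).
- exact: supported_commute SL Sk1 Lh2.
- by apply: commute_sym; apply: supported_commute SL Sh1 Lk2.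
- exact: supported_clique_abelian clq Lk2 Lh2.
Qed.

End CentralizerTheorem.

(** * Universal properties *)

Section UniversalProperties.
Local Open Scope group_scope.

Lemma quot_lift (G K : groupType) (S : set G) (phi : G -> K) :
    {morph phi : x y / x * y} -> (forall s, S s -> phi s = 1) ->
  exists2 psi : quot S -> K, {morph psi : x y / x * y} &
    forall g, psi (quot_proj S g) = phi g.
Proof.
move=> phiM phiS; pose psi (a : quot S) := phi (repr a).
have psiE g : psi (quot_proj S g) = phi g.
  have /quot_projP h : quot_proj S (repr (quot_proj S g)) = quot_proj S g.
    by rewrite quot_projK.
  have N : is_normal_subgroup [set x | phi x = 1].
    split; first split.
    - exact: morph1.
    - by move=> x y /= px py; rewrite phiM px py mulg1.
    - by move=> x /= px; rewrite morphV // px invg1.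
    - by move=> x y /= px; rewrite morphJ // px conj1g.
  have /= := h _ (conj N phiS).
  by rewrite phiM morphV // => /mulg1_eq; rewrite invgK.
exists psi => // a b.
by rewrite -(quot_projK a) -(quot_projK b) -quot_proj_morph !psiE phiM.
Qed.

Lemma free_lift (X : choiceType) (K : groupType) (f : X -> K) :
  exists2 phi : free_group X -> K, {morph phi : x y / x * y} &
    forall x, phi (free_gen x) = f x.
Proof.
pose ev1 (l : X * bool) : K := if l.2 then f l.1 else (f l.1)^-1.
pose ev (w : word X) := \prod_(l <- w) ev1 l.
have ev_cat w w' : ev (w ++ w') = ev w * ev w' by rewrite /ev big_cat.
have ev_eq w w' : free_eq w w' -> ev w = ev w'.
  elim=> {w w'} [w|w w' _ ->|w w' w'' _ -> _ ->|w w' l] //.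
  rewrite !ev_cat; congr (_ * _); rewrite -[RHS]mul1g; congr (_ * _).
  rewrite /ev big_cons big_seq1 /ev1 /letter_inv /=.
  by case: l.2; rewrite ?mulgV ?mulVg.
pose phi (a : free_group X) := ev (repr a).
have phiE w : phi (free_word w) = ev w.
  by apply/ev_eq/free_wordP; rewrite free_wordK.
exists phi => [a b|x]; last by rewrite phiE /ev big_seq1.
rewrite -{1}(free_wordK a) -{1}(free_wordK b).
have -> : free_word (repr a) * free_word (repr b) = free_word (repr a ++ repr b).
  exact: free_wordM.
by rewrite phiE ev_cat.
Qed.

Lemma presented_lift (X : choiceType) (R : set (free_group X)) (K : groupType)
    (f : X -> K) :
    (forall phi : free_group X -> K, {morph phi : x y / x * y} ->
       (forall x, phi (free_gen x) = f x) -> forall r, R r -> phi r = 1) ->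
  exists2 psi : presented R -> K, {morph psi : x y / x * y} &
    forall x, psi (presented_gen R x) = f x.
Proof.
move=> fR; have [phi phiM phif] := free_lift f.
have [psi psiM psiE] := quot_lift phiM (fR phi phiM phif).
by exists psi => // x; rewrite psiE.
Qed.

Lemma presented_ind (X : choiceType) (R : set (free_group X))
    (P : presented R -> Prop) :
    P 1 -> (forall x g, P g -> P (presented_gen R x * g)) ->
    (forall x g, P g -> P ((presented_gen R x)^-1 * g)) ->
  forall g, P g.
Proof.
move=> P1 Pgen PgenV g; rewrite -(quot_projK g) -(free_wordK (repr g)).
elim: (repr (repr g)) => [//|[x b] w IH].
have -> : quot_proj R (free_word ((x, b) :: w)) =
    (quot_proj R (free_word [:: (x, b)]) : presented R) * quot_proj R (free_word w).
  rewrite -(@quot_proj_morph _ R); congr quot_proj.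
  exact: esym (free_wordM [:: (x, b)] w).
case: b; first exact: Pgen.
suff -> : quot_proj R (free_word [:: (x, false)]) = (presented_gen R x)^-1.
  exact: PgenV.
rewrite /presented_gen -(morphV (@quot_proj_morph _ R)); congr quot_proj.
apply: (@mulgI _ (free_gen x)); rewrite mulgV.
apply: etrans (free_wordM _ _) _.
by apply/free_wordP; apply: (free_eq_invr [:: (x, true)]).
Qed.

Lemma presented_ext (X : choiceType) (R : set (free_group X)) (K : groupType)
    (phi psi : presented R -> K) :
    {morph phi : x y / x * y} -> {morph psi : x y / x * y} ->
    (forall x, phi (presented_gen R x) = psi (presented_gen R x)) ->
  phi =1 psi.
Proof.
move=> phiM psiM eq_gen; apply: presented_ind.
- by rewrite !morph1.
- by move=> x g; rewrite phiM psiM eq_gen => ->.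
- by move=> x g; rewrite phiM psiM !morphV // eq_gen => ->.
Qed.

Lemma raag_lift (V : finType) (e : rel V) (K : groupType) (f : V -> K) :
    (forall u v, e u v -> commute (f u) (f v)) ->
  exists2 phi : raag e -> K, {morph phi : x y / x * y} &
    forall v, phi (raag_gen e v) = f v.
Proof.
move=> fC; apply: presented_lift => phi phiM phif _ [u [v [/fC uv ->]]].
by rewrite morphR // !phif; apply/eqP/commgP.
Qed.

Lemma free_product_lift (H K L : groupType) (phi : H -> L) (psi : K -> L) :
    {morph phi : x y / x * y} -> {morph psi : x y / x * y} ->
  exists theta : free_product H K -> L, [/\ {morph theta : x y / x * y},
    forall a, theta (presented_gen _ (inl a)) = phi a &
    forall b, theta (presented_gen _ (inr b)) = psi b].
Proof.
move=> phiM psiM; pose f (x : H + K) := match x with inl a => phi a | inr b => psi b end.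
have [|theta thetaM thetaf] := @presented_lift _ (@free_product_relator H K) _ f.
  move=> chi chiM chif _ [a b|a b]; rewrite !chiM morphV // !chif /= ?phiM ?psiM;
  exact: mulgV.
by exists theta; split=> // [a|b]; rewrite thetaf.
Qed.

End UniversalProperties.

(** * Inner pearls *)

Section GroupFacts.
Variable G : groupType.
Local Open Scope group_scope.
Implicit Types (x y : G) (S : set G).

Lemma commuteJ c x y : commute x y -> commute (x ^ c) (y ^ c).
Proof. by rewrite /commute -!conjMg => ->. Qed.

Lemma commuteJE c x y : commute (x ^ c) y -> commute x (y ^ c^-1).
Proof. by move/(commuteJ c^-1); rewrite conjgK. Qed.

Lemma generated_subgroup S : is_subgroup (generated S).
Proof.
split=> [N [[N1 _ _] _] //|x y Sx Sy N NS|x Sx N NS].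
  by have [[_ NM _] _] := NS; apply: NM; [apply: Sx|apply: Sy].
by have [[_ _ NV] _] := NS; apply: NV; apply: Sx.
Qed.

Lemma generated_sub S : S `<=` generated S.
Proof. by move=> x Sx N [_]; apply. Qed.

Lemma generated_ind S (P : set G) : is_subgroup P -> S `<=` P ->
  generated S `<=` P.
Proof. by move=> sP SP x; apply. Qed.

(** Exponents are natural numbers, so an integer power is written as a product of two powers. *)
Lemma generated_set1 x y : generated [set x] y ->
  exists i j, y = x ^+ i * x^-1 ^+ j.
Proof.
have xV i j : commute (x ^+ i) (x^-1 ^+ j).
  by apply: commuteX2; apply: commuteV; apply: commute_refl.
apply: (generated_ind (P := [set y | exists i j, y = x ^+ i * x^-1 ^+ j])); last first.
  by move=> _ ->; exists 1%N, 0%N; rewrite mulg1.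
split=> /=; first by exists 0%N, 0%N; rewrite mulg1.
  move=> _ _ [i [j ->]] [i' [j' ->]]; exists (i + i')%N, (j + j')%N.
  by rewrite !expgnDr !mulgA -(mulgA (x ^+ i)) -xV !mulgA.
move=> _ [i [j ->]]; exists j, i.
by rewrite invgM -!expVgn invgK.
Qed.

End GroupFacts.

Section Pearls.
Variables (V : finType) (e : rel V).
Hypotheses (e_sym : symmetric e) (e_irr : irreflexive e).
Hypothesis no_square : forall a b u v,
  a != b -> ~~ e a b -> e u a -> e u b -> e v a -> e v b -> u = v.
Implicit Types (u v : V) (l : V * bool) (w : word V) (g h k y : raag e).
Implicit Types (S L : pred V).
Local Open Scope group_scope.

Local Notation elt := (elt e).

Lemma supported_pred1 v g : supported (pred1 v) g ->
  exists s n, g = elt [:: (v, s)] ^+ n.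
Proof.
case=> w vw ->; elim: w vw => [|[u t] w IH] /=; first by exists true, 0%N.
move=> /andP[/eqP -> /IH[s [n ew]]]; rewrite elt_cons ew.
case: (eqVneq t s) => [->|ts]; first by exists s, n.+1; rewrite expgS.
case: n {ew} => [|n]; first by exists t, 1%N; rewrite mulg1.
exists s, n; rewrite expgS mulgA.
have -> : (v, t) = letter_inv (v, s) by rewrite /letter_inv /=; case: t s ts => [] [].
by rewrite elt_letterV mulVg mul1g.
Qed.

Lemma col_letter u l : col u (elt [:: l]) =
  if blocks e u l.1 then [:: entry u l] else [::].
Proof. by rewrite col_elt // column_cons; case: ifP. Qed.

Lemma letter_cyclically_reduced l : cyclically_reduced (elt [:: l]).
Proof.
move=> u s; rewrite col_letter; case: ifP => //= _ -> [].
by case: s.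
Qed.

Lemma support_letter l : support (elt [:: l]) =1 pred1 l.1.
Proof.
move=> u; rewrite /support col_letter /blocks /entry /= eq_sym.
by case: (eqVneq l.1 u) => //= _; case: ifP.
Qed.

Lemma size_col_letterX l n : size (col l.1 (elt [:: l] ^+ n)) = n.
Proof.
rewrite col_expg //; last exact: letter_cyclically_reduced.
by rewrite col_letter blocks_refl size_flatten /shape map_nseq sumn_nseq mul1n.
Qed.

Lemma centralizer_letter l h : commute (elt [:: l]) h ->
  exists h1 h2, [/\ h = h1 * h2, supported (pred1 l.1) h1 & supported (e l.1) h2].
Proof.
move=> /(centralizer_decomposition e_sym e_irr (@letter_cyclically_reduced l)).
move=> [h1 [h2 [-> Sh1 Lh2 _]]]; exists h1, h2; split=> //.
  by apply: supported_sub Sh1 => v; rewrite support_letter.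
apply: supported_sub Lh2 => v /forallP/(_ l.1); rewrite support_letter /= eqxx.
by rewrite e_sym.
Qed.

Lemma inner_pearl_letter y : inner_pearl y -> exists c l a b,
  [/\ y = elt [:: l] ^ c, e l.1 a, e l.1 b, a != b & ~~ e a b].
Proof.
case=> y1 y_nab y_center; have [w rw def_y] := elt_reduced e_sym e_irr y.
have [ws [wc [_ def_w cr]]] := cyclic_decomposition e_sym e_irr rw.
set x := elt wc in cr; pose c := (elt ws)^-1.
have yE : y = x ^ c by rewrite def_y -def_w !elt_cat eltV /conjg invgK.
have x_nab : ~ is_abelian (centralizer x).
  move=> x_ab; apply: y_nab => h k; rewrite /centralizer /= yE.
  move=> /commuteJE xh /commuteJE xk.
  by have := commuteJ c (x_ab _ _ xh xk); rewrite !conjgKV.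
have [a [b [La Lb ab nab]]] := centralizer_nonabelian e_sym e_irr cr x_nab.
have link_e u v : link e (support x) u -> support x v -> e v u.
  by move=> /forallP/(_ v)/implyP Lu /Lu; rewrite e_sym.
have [v Sv] : exists v, support x v.
  apply: contrapT => /forallNP nS; apply: y1; rewrite yE.
  suff -> : x = 1 by rewrite conj1g.
  have [[|l u] Su -> //] := supported_support e_sym e_irr x.
  by case/andP: Su => /nS.
(* All vertices of the support are common neighbours of [a] and [b]. *)
have SvE u : support x u -> u = v.
  by move=> Su; apply: (no_square ab nab); apply: link_e.
have [s [n def_x]] : exists s n, x = elt [:: (v, s)] ^+ n.
  apply: supported_pred1; apply: supported_sub (supported_support e_sym e_irr x).
  by move=> u /SvE ->; rewrite /= eqxx.
pose z := elt [:: (v, s)]; exists c, (v, s), a, b.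
split=> //=; do ?exact: link_e.
have zx : commute x z by rewrite def_x; apply: commute_sym; apply: commuteX.
(* The letter [z] commutes with the whole centralizer of its power [x], so [z ^ c] lies in the
   center generated by [y]. *)
have : generated [set y] (z ^ c).
  rewrite -y_center yE; split=> [|h]; first exact: commuteJ.
  move=> /commuteJE xh; suff /(commuteJ c) : commute z (h ^ c^-1).
    by rewrite conjgKV.
  have [h1 [h2 [-> Sh1 Lh2 _]]] := centralizer_decomposition e_sym e_irr cr xh.
  have Sz : supported (support x) z by exists [:: (v, s)]; rewrite //= Sv.
  apply: commuteM.
    apply: supported_clique_abelian Sz Sh1 => //.
    by move=> u u' /SvE -> /SvE ->; rewrite eqxx.
  apply: supported_commute Sz Lh2 => u u' Su Lu'; exact: link_e.
move=> /generated_set1[i [j]]; rewrite yE -conjVg -!conjXg -conjMg.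
move=> /conjg_inj eqz; have {eqz} : z * x ^+ j = x ^+ i.
  by rewrite {1}eqz expVgn mulgVK.
(* Comparing lengths gives [1 + n * j = n * i], which forces [n = 1]. *)
rewrite def_x -/z -!expgnA -expgS => /(congr1 (fun g => size (col v g))).
rewrite !(size_col_letterX (v, s)).
case: n def_x => [|[|n]] //.
move=> _ /(congr1 (fun m => m %% n.+2)%N).
by rewrite -addn1 [(n.+2 * j)%N]mulnC modnMDl modnMr modn_small.
Qed.

End Pearls.

(** * Quotients splitting off the integers *)

Section FreeProducts.
Local Open Scope group_scope.
Variables H K : groupType.

Definition inl_gen (a : H) : free_product H K := presented_gen _ (inl a).
Definition inr_gen (b : K) : free_product H K := presented_gen _ (inr b).

Lemma quot_relator (G : groupType) (S : set G) (g : G) : S g -> quot_proj S g = 1.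
Proof.
move=> Sg; apply: esym; apply/quot_projP; rewrite invg1 mul1g.
by move=> N [_]; apply.
Qed.

Lemma inl_gen_morph : {morph inl_gen : x y / x * y}.
Proof.
move=> a b; have := quot_relator (free_product_relator_l K a b).
rewrite !quot_proj_morph (morphV (@quot_proj_morph _ _)).
by move/divg1_eq/esym.
Qed.

Lemma inr_gen_morph : {morph inr_gen : x y / x * y}.
Proof.
move=> a b; have := quot_relator (free_product_relator_r H a b).
rewrite !quot_proj_morph (morphV (@quot_proj_morph _ _)).
by move/divg1_eq/esym.
Qed.

Lemma free_product_ind (P : free_product H K -> Prop) :
    P 1 -> (forall a g, P g -> P (inl_gen a * g)) ->
    (forall b g, P g -> P (inr_gen b * g)) ->
  forall g, P g.
Proof.
move=> P1 Pl Pr; apply: presented_ind => // [] [a|b] g Pg.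
- exact: Pl.
- exact: Pr.
- by rewrite -(morphV inl_gen_morph); apply: Pl.
- by rewrite -(morphV inr_gen_morph); apply: Pr.
Qed.

End FreeProducts.

Lemma morph_int_ext (G : groupType) (phi psi : Algebra.to_multiplicative int -> G) :
    {morph phi : x y / (x * y)%g} -> {morph psi : x y / (x * y)%g} ->
  phi 1%R = psi 1%R -> phi =1 psi.
Proof.
move=> phiM psiM eq1; elim/int_rec => [|n IH|n IH].
- by rewrite (morph1 phiM) (morph1 psiM).
- have -> : Posz n.+1 = ((1%R : Algebra.to_multiplicative int) * Posz n)%g.
    by rewrite /monoid.mul /= -intS.
  by rewrite phiM psiM eq1 IH.
have -> : (- Posz n.+1)%R = ((1%R : Algebra.to_multiplicative int)^-1 * (- Posz n)%R)%g.
  by rewrite /monoid.mul /monoid.inv /= intS GRing.opprD.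
by rewrite phiM psiM (morphV phiM 1%R) (morphV psiM 1%R) eq1 IH.
Qed.

(** * The affine group of [F_3], dihedral of order 6 *)

Section Dihedral.
Import GRing.Theory.
Local Open Scope ring_scope.
Local Notation F := 'F_3.

Definition translation (d : F) : {perm F} := perm (@addIr _ d).
Definition reflection (d : F) : {perm F} := perm (@subrI _ d).

Lemma translationE d x : translation d x = x + d. Proof. exact: permE. Qed.
Lemma reflectionE d x : reflection d x = d - x. Proof. exact: permE. Qed.

Lemma translation_commute c d : commute (translation c) (translation d).
Proof. by apply/permP => x; rewrite !permM !translationE addrAC. Qed.

Lemma translation0 : translation 0 = 1%g.
Proof. by apply/permP => x; rewrite translationE perm1 addr0. Qed.

Definition reflection_power d (n : Algebra.to_multiplicative int) : {perm F} :=
  if odd (absz n) then reflection d else 1%g.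

Lemma reflection_power_morph d :
  {morph reflection_power d : x y / (x * y)%g}.
Proof.
have reflectionK : (reflection d * reflection d)%g = 1%g.
  by apply/permP => x; rewrite permM !reflectionE perm1 opprB addrC subrK.
move=> m n; rewrite /reflection_power.
have -> : odd (absz (m * n)%g) = odd (absz m) (+) odd (absz n).
  rewrite /monoid.mul /=; lia.
by case: (odd _); case: (odd _); rewrite /= ?reflectionK ?mulg1 ?mul1g.
Qed.

End Dihedral.


(** * Counting homomorphisms from the quotient to the affine group *)

Section Splitting.
Import GRing.Theory.
Local Open Scope group_scope.
Variables (V : finType) (e : rel V) (v : V) (Q : groupType) (pr : V -> Q).
Hypothesis e_irr : irreflexive e.
(** The quotient enters only through generation by the images of the vertices, their commutation and
    the universal property, so that its relator may be any conjugate of [v] or of its inverse. *)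
Hypothesis Q_ind : forall P : Q -> Prop,
  P 1 -> (forall u g, P g -> P (pr u * g)) ->
  (forall u g, P g -> P ((pr u)^-1 * g)) -> forall g, P g.
Hypothesis pr_comm : forall u u', e u u' -> commute (pr u) (pr u').
Hypothesis pr_v : pr v = 1.
Hypothesis Q_lift : forall (K : groupType) (f : V -> K),
  (forall u u', e u u' -> commute (f u) (f u')) -> f v = 1 ->
  exists2 phi : Q -> K, {morph phi : x y / x * y} & forall u, phi (pr u) = f u.

Local Notation D := {perm 'F_3}.

Lemma hom_ext (K : groupType) (phi psi : Q -> K) : {morph phi : x y / x * y} ->
  {morph psi : x y / x * y} -> (forall u, phi (pr u) = psi (pr u)) -> phi =1 psi.
Proof.
move=> phiM psiM eq_pr; apply: Q_ind => [|u g IH|u g IH].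
- by rewrite !morph1.
- by rewrite phiM psiM eq_pr IH.
- by rewrite phiM psiM !morphV // eq_pr IH.
Qed.

Section Factor.
Variables (H : groupType).
Local Notation Z := (Algebra.to_multiplicative int).
Variables (f : Q -> free_product H Z) (f' : free_product H Z -> Q).
Hypotheses (fM : {morph f : x y / x * y}) (f'M : {morph f' : x y / x * y}).
Hypotheses (fK : cancel f f') (f'K : cancel f' f).

Let t : free_product H Z := inr_gen H (1%R : Z).

(** This is the linear part of the affine actions to come: 1 on [H] and -1 on the generator of
    [Z]. *)
Lemma sign_exists : exists sg : free_product H Z -> D,
  [/\ {morph sg : x y / x * y}, forall a, sg (inl_gen Z a) = 1,
    forall n, sg (inr_gen H n) = reflection_power 0%R n &
    forall g x y, sg g (x + y)%R = (sg g x + sg g y)%R].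
Proof.
pose triv (a : H) : D := 1.
have trivM : {morph triv : x y / x * y} by move=> a b; rewrite /triv mulg1.
have [sg [sgM sgl sgr]] := free_product_lift trivM (reflection_power_morph 0%R).
exists sg; split=> //; apply: free_product_ind => [|a g IH|n g IH] x y.
- by rewrite morph1 // !perm1.
- by rewrite sgM sgl mul1g IH.
rewrite sgM sgr !permM -IH; congr (sg g _).
rewrite /reflection_power; case: ifP => _; last by rewrite !perm1.
by rewrite !reflectionE !sub0r opprD.
Qed.

Variable sg : free_product H Z -> D.
Hypotheses (sgM : {morph sg : x y / x * y})
  (sgl : forall a, sg (inl_gen Z a) = 1)
  (sgr : forall n, sg (inr_gen H n) = reflection_power 0%R n)
  (sgD : forall g x y, sg g (x + y)%R = (sg g x + sg g y)%R).

(** [theta] agrees on [H] with the action [phi] by translations, but sends [t] to a reflection. That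
    reflection has the same value at 0 as [phi (f' t)], so that [theta] still determines [phi]. *)
Definition dihedral_hom (psi : {ffun V -> 'F_3}) (theta : free_product H Z -> D) :=
  {morph theta : x y / x * y} /\
  (forall g x, theta g x = (sg g x + theta g 0)%R) /\
  exists2 phi : Q -> D, {morph phi : x y / x * y} &
    [/\ forall u, phi (pr u) = translation (if u == v then 0%R else psi u),
      forall g x, phi g x = (x + phi g 0)%R,
      forall a, theta (inl_gen Z a) = phi (f' (inl_gen Z a)) &
      theta t = reflection (phi (f' t) 0%R)].

Lemma dihedral_hom_exists psi : exists theta, dihedral_hom psi theta.
Proof.
have [||phi phiM phiE] := @Q_lift D
    (fun u => translation (if u == v then 0%R else psi u)).
- by move=> u u' _; apply: translation_commute.
- by rewrite eqxx translation0.
have phi_tr : forall g x, phi g x = (x + phi g 0)%R.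
  have trV d : (translation d)^-1 = translation (- d)%R.
    by apply: mulg1_eq; apply/permP => x; rewrite permM !translationE perm1 addrK.
  apply: Q_ind => [|u g IH|u g IH] x.
  - by rewrite morph1 // !perm1 addr0.
  - by rewrite phiM phiE !permM IH (IH (translation _ _)) !translationE add0r addrA.
  - rewrite phiM morphV // phiE trV !permM IH (IH (translation _ _)).
    by rewrite !translationE add0r addrA.
pose phil0 (a : H) := phi (f' (inl_gen Z a)).
have phil : {morph phil0 : x y / x * y}.
  by move=> a b; rewrite /phil0 inl_gen_morph f'M phiM.
have [theta [thetaM thetal thetar]] := free_product_lift phil
  (reflection_power_morph (phi (f' t) 0%R)).
exists theta; split=> //; split; last first.
  by exists phi => //; split=> //; rewrite [theta t]thetar.
apply: free_product_ind => [|a g IH|n g IH] x.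
- by rewrite (morph1 thetaM) (morph1 sgM) !perm1 addr0.
- rewrite thetaM sgM sgl mul1g thetal !permM IH [X in _ = (_ + X)%R]IH addrA -sgD.
  by rewrite /phil0 -phi_tr.
rewrite thetaM sgM sgr thetar !permM IH [X in _ = (_ + X)%R]IH addrA -sgD.
congr (sg g _ + _)%R.
rewrite /reflection_power; case: ifP => _; last by rewrite !perm1 addr0.
by rewrite !reflectionE subr0 sub0r addrC.
Qed.

(** As the linear part is fixed, the values at 0 on the vertices determine [theta]; this determines
    [phi] on [H] and on [t], hence [psi]. *)
Lemma dihedral_hom_inj psi psi' theta theta' :
    dihedral_hom psi theta -> dihedral_hom psi' theta' ->
    (forall u, theta (f (pr u)) 0%R = theta' (f (pr u)) 0%R) ->
  forall u, u != v -> psi u = psi' u.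
Proof.
move=> [thM [thA [phi phiM [phiE phi_tr thl tht]]]].
move=> [th'M [th'A [phi' phi'M [phi'E phi'_tr th'l th't]]]] eq0.
have eqth : theta \o f =1 theta' \o f.
  apply: hom_ext => [x y|x y|u] /=; rewrite ?fM ?thM ?th'M //.
  by apply/permP => x; rewrite thA th'A eq0.
have {}eqth g : theta g = theta' g by have := eqth (f' g); rewrite /= f'K.
have eqt : phi (f' t) = phi' (f' t).
  have := eqth t; rewrite tht th't => /permP/(_ 0%R).
  rewrite !reflectionE !subr0 => eqt.
  by apply/permP => x; rewrite phi_tr phi'_tr eqt.
have eqZ : forall n, phi (f' (inr_gen H n)) = phi' (f' (inr_gen H n)).
  apply: morph_int_ext => // m n; by rewrite inr_gen_morph f'M ?phiM ?phi'M.
have eqphi : forall g, phi (f' g) = phi' (f' g).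
  apply: free_product_ind => [|a g IH|n g IH].
  - by rewrite !(morph1 f'M) !morph1.
  - by rewrite !f'M phiM phi'M IH -thl -th'l eqth.
  - by rewrite !f'M phiM phi'M IH eqZ.
move=> u nuv; have := eqphi (f (pr u)); rewrite fK phiE phi'E (negPf nuv).
by move=> /permP/(_ 0%R); rewrite !translationE !add0r.
Qed.

(** Otherwise [sg] would be trivial on a generating set, whereas [t] is sent to a reflection. *)
Lemma sign_nontrivial : exists u, sg (f (pr u)) 1%R != 1%R.
Proof.
apply: contrapT => /forallNP sg1.
have sg11 g (h := sg g) : h 1%R = 1%R -> h = 1.
  move=> h1; apply/permP => x; rewrite perm1.
  have x_nat : x = (1%R *+ x)%R by rewrite Zp_nat; apply: val_inj; rewrite /= modn_small.
  rewrite x_nat; elim: (x : nat) => [|n IH].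
    by apply: (@addrI _ (h 0%R)); rewrite /h -sgD !addr0.
  by rewrite mulrSr /h sgD -!/(h _) h1 IH.
have : sg \o f =1 fun=> 1.
  apply: hom_ext => [x y|x y|u] /=; rewrite ?fM ?sgM ?mulg1 //.
  by apply: sg11; apply/eqP/negPn/negP/sg1.
move/(_ (f' t)); rewrite /= f'K sgr /reflection_power /= => /permP/(_ 1%R).
by rewrite reflectionE perm1.
Qed.

(* Every choice of translations [psi] on the vertices other than [v] gives a
   homomorphism from [H * Z] to the affine group of [F_3], where [H] acts by
   translations and the generator of [Z] by a reflection, and the translation
   parts of the images of the vertices determine [psi].  By counting, these
   translation parts are arbitrary; but a vertex acting by a reflection
   constrains those of its neighbours. *)
Lemma pendant_of_factor : exists2 u, u != v & forall u', e u u' -> u' = v.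
Proof.
have [u sgu] := sign_nontrivial.
have nuv : u != v.
  by apply: contraNneq sgu => ->; rewrite pr_v !morph1 // perm1.
exists u => // u' euu'; apply/eqP/negPn/negP => nu'v.
have [th thP] := choice dihedral_hom_exists.
(* The translation part at [v] is always 0; keeping [psi v] there instead makes [F] injective. *)
pose F (psi : {ffun V -> 'F_3}) : {ffun V -> 'F_3} :=
  [ffun w => if w == v then psi w else th psi (f (pr w)) 0%R].
have F_inj : injective F.
  move=> psi psi' /ffunP eqF; apply/ffunP => w.
  case: (eqVneq w v) => [->|nwv]; first by have := eqF v; rewrite !ffunE eqxx.
  apply: (dihedral_hom_inj (thP psi) (thP psi')) nwv => {}w.
  case: (eqVneq w v) => [->|nwv]; last by have := eqF w; rewrite !ffunE (negPf nwv).
  have [[thM _] [th'M _]] := (thP psi, thP psi').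
  by rewrite pr_v (morph1 fM) (morph1 thM) (morph1 th'M).
(* An injective self-map of a finite set is onto, so translation parts 0 at [u] and 1 at [u']
   occur. *)
have [psi /ffunP psiF] : exists psi, F psi = [ffun w => if w == u' then 1%R else 0%R].
  by exists (invF F_inj [ffun w => if w == u' then 1%R else 0%R]); rewrite f_invF.
have [thM [thA _]] := thP psi.
have nuu' : u != u' by apply: contraTneq euu' => ->; rewrite e_irr.
have th_u := psiF u; have th_u' := psiF u'.
rewrite !ffunE (negPf nuv) (negPf nuu') in th_u.
rewrite !ffunE (negPf nu'v) eqxx in th_u'.
(* Evaluated at 0, the commutation of [u] and [u'] says that the linear part of [u] fixes 1. *)
have := morph_commute thM (morph_commute fM (pr_comm euu')).
move=> /permP/(_ 0%R); rewrite !permM th_u th_u' thA th_u addr0 => sgu1.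
by rewrite -sgu1 eqxx in sgu.
Qed.

End Factor.

Lemma pendant_of_splitting : splits_off_Z Q ->
  exists2 u, u != v & forall u', e u u' -> u' = v.
Proof.
move=> [H [f [f' fK f'K]]]; have fM := @gmulfM _ _ f.
have f'M := can2_gmulfM fK f'K.
have [sg [sgM sgl sgr sgD]] := sign_exists H.
exact: pendant_of_factor fM f'M fK f'K sg sgM sgl sgr sgD.
Qed.

End Splitting.

(** * Two nonadjacent vertices *)

Section FreePair.
Local Open Scope group_scope.
Variables (V : finType) (e : rel V).
Hypotheses (e_sym : symmetric e) (e_irr : irreflexive e).
Variables (p q : V).
Hypotheses (neq_pq : p != q) (nadj_pq : ~~ e p q).
Implicit Types (u v : V) (l m : V * bool) (w x y : word V) (g h : raag e).

Local Notation elt := (elt e).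
Local Notation column := (column e).
Local Notation reduced := (reduced e).
Local Notation blocks := (blocks e).

Let S : pred V := pred2 p q.
Local Notation over w := (all (fun l => S l.1) w).
Local Notation is_q := (fun l : V * bool => l.1 == q).

(** Hence for words over [p] and [q] each of these two columns records every letter, and
    cancellation is that of a free group. *)
Lemma pair_blocks u v : S u -> S v -> blocks u v.
Proof.
rewrite /blocks => /pred2P[] -> /pred2P[] ->; rewrite ?eqxx ?nadj_pq ?orbT //.
by rewrite e_sym nadj_pq orbT.
Qed.

Lemma reduced_sorted w : over w ->
  reduced w = sorted (fun l m => m != letter_inv l) w.
Proof.
elim: w => // l [|m w] IH //= /and3P[Sl Sm Sw].
have := IH; rewrite /= Sm Sw => /(_ isT) ->; congr (_ && _).
rewrite column_cons pair_blocks // /entry /=; case: m {IH Sm} => v s /=.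
rewrite /letter_inv xpair_eqE; case: (v =P l.1) => // _ /=.
Qed.

Lemma column_inj w x : over w -> over x ->
  (forall v, S v -> column v w = column v x) -> w = x.
Proof.
have colS u l y : S u -> S l.1 -> column u (l :: y) = entry u l :: column u y.
  by move=> Su Sl; rewrite column_cons pair_blocks.
have Sp : S p by rewrite /S /= eqxx.
elim: w x => [|l w IH] [|m x] //=.
- by move=> _ /andP[Sm _] /(_ p Sp); rewrite colS.
- by move=> /andP[Sl _] _ /(_ p Sp); rewrite colS.
move=> /andP[Sl Sw] /andP[Sm Sx] eqc; congr (_ :: _); last first.
  by apply: IH => // v Sv; have := eqc v Sv; rewrite !colS // => -[].
have := eqc _ Sl; rewrite !colS // /entry eqxx => -[].
by case: eqP => // eqv [eqs] _; rewrite (surjective_pairing l) eqs -eqv; case: (m).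
Qed.

Lemma supported_reduced g : supported S g -> exists2 w, over w & reduced w /\ g = elt w.
Proof.
case=> w Sw ->; have [w' [rw' <- sub _]] := reduce_word e_sym e_irr w.
by exists w' => //; apply/allP => l /sub lw; apply: (allP Sw).
Qed.

(** Over [p] and [q], being reduced is a condition on consecutive letters only. *)
Lemma reduced_cat_overlap w1 w2 w3 : reduced (w1 ++ w2) -> reduced (w2 ++ w3) ->
  over (w1 ++ w2 ++ w3) -> w2 != [::] -> reduced (w1 ++ w2 ++ w3).
Proof.
move=> r12 r23 S123; have := S123; rewrite !all_cat => /and3P[S1 S2 S3].
case: w2 r12 r23 S123 S2 => // m w2 r12 r23 S123 S2 _; move: r12 r23.
rewrite !reduced_sorted ?all_cat ?S1 ?S2 ?S3 //.
case: w1 {S1 S123} => [//|l w1] /=; rewrite !cat_path /= !cat_path.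
by move=> /and3P[-> -> ->] /andP[].
Qed.

(** The default letter [(p, true)] excludes the empty word. *)
Definition q_block w := [&& over w, reduced w, is_q (head (p, true) w) &
  is_q (last (p, true) w)].

Lemma q_block_inv w : q_block w -> q_block (word_inv w).
Proof.
move=> /and4P[Sw rw hw lw]; apply/and4P; split.
- by rewrite all_rev all_map.
- exact: reduced_inv.
- rewrite /word_inv -map_rev; case/lastP: w lw {Sw rw hw} => // w l.
  by rewrite last_rcons rev_rcons.
- rewrite /word_inv; case: w hw {Sw rw lw} => // l w.
  by rewrite /= rev_cons last_rcons.
Qed.

Lemma count_word_inv w : count is_q (word_inv w) = count is_q w.
Proof. by rewrite count_rev count_map; apply: eq_count. Qed.

Lemma q_block_count w : q_block w -> (count is_q w <= 1)%N ->
  exists s, w = [:: (q, s)].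
Proof.
move=> /and4P[_ _]; case: w => [|[v s] w] /=; first by rewrite (negPf neq_pq).
move=> /eqP ->; rewrite eqxx; case/lastP: w => [|w l]; first by exists s.
by rewrite last_rcons -cats1 count_cat /= => -> h; exfalso; move: h => /=; lia.
Qed.

(* As [count is_q w] is odd, the cyclically reduced core of [w] is not empty,
   so that the powers of [elt w] cancel only within the conjugating parts. *)
Lemma q_block_power w n : q_block w -> odd (count is_q w) ->
  exists x, [/\ q_block x, elt x = elt w ^+ n.+1 &
    (count is_q w <= count is_q x)%N].
Proof.
move=> /and4P[Sw rw hw lw] oddw.
have [ws [wc [rwsc ewsc crc]]] := cyclic_decomposition e_sym e_irr rw.
set w' := ws ++ wc ++ word_inv ws in rwsc ewsc.
(* Reduced words over [p] and [q] are unique, so the decomposition is one of the word [w] itself. *)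
have colE v : column v w' = column v w by apply: reduced_column.
have Sw' : over w'.
  have : supported S (elt w') by rewrite ewsc; exists w.
  move/(supportedP e_sym e_irr) => h; apply/allP => l lw'.
  apply/negPn/negP => /h; rewrite col_elt // => /allP/(_ (Some l.2)).
  suff -> : Some l.2 \in column l.1 w' by move/(_ isT).
  apply/mapP; exists l; last by rewrite /entry eqxx.
  by rewrite mem_filter blocks_refl.
have {Sw' colE} def_w : w' = w by apply: column_inj => // v _; apply: colE.
move: Sw rw hw lw oddw {ewsc}; rewrite -{}def_w /w' => Sw rw hw lw oddw.
have [Sws Swc Swi] : [/\ over ws, over wc & over (word_inv ws)].
  by move: Sw; rewrite !all_cat => /and3P.
have oddwc : odd (count is_q wc).
  by move: oddw; rewrite !count_cat count_word_inv addnCA addnn oddD odd_double addbF.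
have wc0 : wc != [::] by apply: contraTneq oddwc => ->.
pose F (k : nat) := flatten (nseq k wc).
have SF (m : nat) : over (F m) by elim: m => //= m IH; rewrite all_cat Swc.
have FS (m : nat) : F m.+1 = F m ++ wc.
  elim: m => [|m IH]; first by rewrite /F /= cats0.
  by rewrite -[LHS]/(wc ++ F m.+1) {1}IH catA.
have rwcwc : reduced (wc ++ wc).
  have rwc : reduced wc by apply: reduced_catl (reduced_catr rw).
  by apply: reduced_cat => // v s; have := crc v s; rewrite col_elt.
have rF (m : nat) : reduced (F m.+1).
  elim: m => [|m IH]; first by rewrite /F /= cats0; apply: reduced_catl rwcwc.
  by apply: (@reduced_cat_overlap wc wc (F m)) => //; rewrite !all_cat Swc SF.
have rwsF (m : nat) : reduced (ws ++ F m.+1).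
  apply: (@reduced_cat_overlap ws wc (F m)) => //.
  - by move: rw; rewrite catA; apply: reduced_catl.
  - exact: (rF m).
  - by rewrite !all_cat Sws Swc SF.
exists (ws ++ F n.+1 ++ word_inv ws); split.
- apply/and4P; split.
  + by rewrite !all_cat Sws SF Swc Swi.
  + rewrite FS -catA (catA ws); apply: reduced_cat_overlap => //.
    * by rewrite -catA -FS.
    * exact: reduced_catr rw.
    * by rewrite !all_cat Sws SF Swc.
  + by rewrite /F /=; case: (ws) hw => //=; case: (wc) wc0.
  + move: lw; rewrite FS !last_cat; case/lastP: (wc) wc0 => // wc1 l _.
    by rewrite !last_rcons.
- have eltF (m : nat) : elt (F m) = elt wc ^+ m.
    by elim: m => // m IH; rewrite /F /= elt_cat IH expgS.
  rewrite (elt_cat _ ws) (elt_cat _ (F n.+1)) eltF eltV !(elt_cat _ ws) elt_cat eltV.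
  have conjE g : elt ws * (g * (elt ws)^-1) = g ^ (elt ws)^-1.
    by rewrite /conjg invgK.
  by rewrite !conjE conjXg.
- by rewrite FS !count_cat leq_add2l leq_add2r leq_addl.
Qed.

Lemma q_block_powers w s n : q_block w -> odd (count is_q w) ->
  exists x, [/\ q_block x, elt x = (if s then elt w else (elt w)^-1) ^+ n.+1 &
    (count is_q w <= count is_q x)%N].
Proof.
move=> bw ow; case: s; first exact: q_block_power.
rewrite -eltV -(count_word_inv w); apply: q_block_power; first exact: q_block_inv.
by rewrite count_word_inv.
Qed.

Lemma split_power x s : reduced ((q, s) :: x) -> over x ->
  exists n x', [/\ (q, s) :: x = nseq n.+1 (q, s) ++ x', reduced x', over x' &
    ~~ is_q (head (p, true) x')].
Proof.
elim: x => [|[v t] x IH] rx Sx; first by exists 0%N, [::].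
case: (eqVneq v q) => [vq|nvq]; last first.
  by exists 0%N, ((v, t) :: x); split=> //; case/andP: rx.
have /andP[_ Sx'] := Sx; have Sq : S q by rewrite /S /= eqxx orbT.
have ts : t = s.
  move: rx; rewrite reduced_sorted /= ?Sq // vq => /andP[+ _].
  by rewrite /letter_inv /=; case: s t {IH Sx} => [] [] //; rewrite eqxx.
have rx' : reduced ((q, s) :: x) by move: rx; rewrite vq ts => /andP[].
have [n [x' [def_x rx'' Sx'' nq]]] := IH rx' Sx'.
by exists n.+1, x'; split=> //; rewrite vq ts def_x.
Qed.

(** * Substituting a block for [q] *)

Section Substitution.
Variables (w : word V) (Phi : raag e -> raag e).
Hypotheses (bw : q_block w) (odd_w : odd (count is_q w))
  (big_w : (2 < count is_q w)%N).
Hypotheses (PhiM : {morph Phi : g h / g * h})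
  (Phi_p : Phi (raag_gen e p) = raag_gen e p) (Phi_q : Phi (raag_gen e q) = elt w).

Lemma substitution_letter_p s : Phi (elt [:: (p, s)]) = elt [:: (p, s)].
Proof.
case: s; first exact: Phi_p.
by rewrite -[(p, false)]/(letter_inv (p, true)) elt_letterV morphV // elt_gen Phi_p.
Qed.

Lemma substitution_letter_q s :
  Phi (elt [:: (q, s)]) = if s then elt w else (elt w)^-1.
Proof.
case: s; first exact: Phi_q.
by rewrite -[(q, false)]/(letter_inv (q, true)) elt_letterV morphV // elt_gen Phi_q.
Qed.

(** Runs of [q] become blocks with [q] at both ends, separated by letters of [p], so that nothing
    cancels between them. The clauses on the first letter carry this through the induction. *)
Lemma substitution_reduced x : over x -> reduced x -> exists y,
  [/\ over y, reduced y, elt y = Phi (elt x),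
     is_q (head (p, true) y) = is_q (head (p, true) x) /\
     (~~ is_q (head (p, true) x) -> ohead y = ohead x) &
     has is_q x -> (2 < count is_q y)%N].
Proof.
have [n] := ubnP (size x); elim: n x => // n IH [|[v s] x] /ltnSE szx Sx rx.
  by exists [::]; split=> //; rewrite elt_nil morph1.
have Sp : S p by rewrite /S /= eqxx.
have /andP[Sv Sx'] := Sx; have /andP[_ rx'] := rx.
case: (eqVneq v q) rx Sv Sx => [-> | nvq] rx Sv Sx.
  (* A maximal run is replaced at once, because consecutive copies of [w] may cancel partially. *)
  have [k [x' [def_x rx'' Sx'' nq]]] := split_power rx Sx'.
  have [z [bz ez cz]] := q_block_powers s k bw odd_w.
  have [|y [Sy ry ey [qy hy] _]] := IH x' _ Sx'' rx''.
    move: szx (congr1 size def_x); rewrite size_cat size_nseq /=.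
    by clear; lia.
  have /and4P[Sz rz hz lz] := bz.
  have z0 : z != [::] by apply: contraTneq hz => ->; rewrite /= (negPf neq_pq).
  exists (z ++ y); split.
  - by rewrite all_cat Sz.
  - rewrite reduced_sorted ?all_cat ?Sz //.
    move: rz ry; rewrite !reduced_sorted //.
    case: z z0 lz {ez cz bz hz Sz} => // l z _ lz; rewrite /= cat_path => ->.
    move: qy; rewrite (negPf nq); case: y {Sy ey hy} => // m y /= nqm -> /=.
    by rewrite andbT; apply: contraFneq nqm => ->; rewrite /letter_inv.
  - rewrite elt_cat ey ez def_x elt_cat PhiM; congr (_ * _).
    rewrite -(substitution_letter_q s) -morphX //; congr Phi.
    by elim: (k.+1) => //= j IHj; rewrite expgS IHj -elt_cons.
  - split; last by rewrite /= ?eqxx.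
    by case: z z0 hz {ez cz bz Sz rz lz} => //= l z _ ->; rewrite eqxx.
  - by move=> _; rewrite count_cat (leq_trans big_w) // (leq_trans cz) ?leq_addr.
have vp : v = p by move: Sv; rewrite /S /= (negPf nvq) orbF => /eqP.
have [y [Sy ry ey [qy hy] cy]] := IH x szx Sx' rx'.
exists ((v, s) :: y); split=> //.
- by rewrite /= Sv.
- rewrite reduced_sorted /= ?Sv //; move: rx ry; rewrite !reduced_sorted //=.
  case: y Sy ey qy hy cy => //= m y _ _ qy hy _; rewrite andbC => + ->.
  case: (boolP (is_q m)) => [qm _|nqm].
    by rewrite /=; apply: contraTneq qm => ->; rewrite /= (negPf nvq).
  move: qy hy; rewrite (negPf nqm); case: x {IH szx Sx Sx' rx'} => [|m' x] /=.
    by move=> _ /(_ neq_pq).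
  by move=> <- /(_ isT)[<-] /andP[->].
- by rewrite (elt_cons _ _ y) ey (elt_cons _ _ x) PhiM vp substitution_letter_p.
- by rewrite /= (negPf nvq).
- by rewrite /= (negPf nvq) => /cy.
Qed.

End Substitution.

Lemma q_core_word w : exists w1 w' w2, [/\ w = w1 ++ w' ++ w2,
  all (fun l => ~~ is_q l) w1, all (fun l => ~~ is_q l) w2 &
  w' = [::] \/ is_q (head (p, true) w') && is_q (last (p, true) w')].
Proof.
have stripl x : exists x1 x2, [/\ x = x1 ++ x2, all (fun l => ~~ is_q l) x1 &
    x2 = [::] \/ is_q (head (p, true) x2)].
  elim: x => [|l x [x1 [x2 [-> ax1 hx2]]]]; first by exists [::], [::]; split; auto.
  case: (boolP (is_q l)) => ql.
    by exists [::], (l :: x1 ++ x2); split; auto.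
  by exists (l :: x1), x2; rewrite /= ql.
have [w1 [w3 [-> aw1 hw3]]] := stripl w.
have [r2 [r1 [er ar2 hr1]]] := stripl (rev w3).
have ew3 : w3 = rev r1 ++ rev r2 by rewrite -rev_cat -er revK.
exists w1, (rev r1), (rev r2); rewrite all_rev -ew3; split=> //.
case: hr1 hw3 => [->|hr1]; first by left.
rewrite ew3; case: r1 {er ew3} hr1 => [|l r1] /= ql.
  by move: ql; rewrite (negPf neq_pq).
case: (lastP r1) => [|r m].
  by rewrite /= ql; right.
rewrite -rcons_cons rev_rcons /= rev_cons last_rcons ql.
by case=> // ->; right.
Qed.

Lemma count_is_q0 w : all (fun l => ~~ is_q l) w -> count is_q w = 0.
Proof. by move=> h; apply/eqP; rewrite -leqn0 leqNgt -has_count -all_predC. Qed.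

Lemma pair_word_p w : over w -> all (fun l => ~~ is_q l) w ->
  all (fun l => pred1 p l.1) w.
Proof.
elim: w => //= l w IH /andP[Sl Sw] /andP[ql aw]; rewrite IH // andbT.
by move: Sl; rewrite /S /= (negPf ql) orbF.
Qed.

(** The exponent sum of [q] has the parity of the number of its letters and vanishes on [p]; if it
    were even on [g], it would be even on the generated subgroup. *)
Lemma exponent_parity g h : generated [set g; raag_gen e p] h ->
    forall w x, g = elt w -> h = elt x ->
  odd (count is_q x) -> odd (count is_q w).
Proof.
have [expo expoM expo_gen] := @raag_lift _ e (Algebra.to_multiplicative int)
  (fun v => if v == q then 1%R else 0%R) (fun _ _ _ => GRing.addrC _ _).
have expoE w : odd (absz (expo (elt w))) = odd (count is_q w).
  elim: w => [|[v s] w IH]; first by rewrite elt_nil morph1.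
  rewrite elt_cons expoM /= oddD -IH.
  have -> : odd (absz (expo (elt [:: (v, s)]) * expo (elt w))) =
      odd (absz (expo (elt [:: (v, s)]))) (+) odd (absz (expo (elt w))).
    by move: (expo _) (expo _) => a b; rewrite /monoid.mul /=; lia.
  congr (_ (+) _); case: s; rewrite ?elt_gen ?expo_gen; first by case: (v == q).
  rewrite -[(v, false)]/(letter_inv (v, true)) elt_letterV morphV // elt_gen expo_gen.
  by case: (v == q).
move=> gh w x eg eh oddx; rewrite -expoE -eg; apply/negPn/negP => evg.
have : ~~ odd (absz (expo h)).
  apply: (generated_ind (P := [set k | ~~ odd (absz (expo k))])) gh.
    split=> [|a b /=|a /=]; first by rewrite /= morph1.
      rewrite expoM; move: (expo a) (expo b) => i j; rewrite /monoid.mul /=; lia.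
    by rewrite morphV //; move: (expo a) => i; rewrite /monoid.inv /=; lia.
  move=> k [->//|->] /=; rewrite expo_gen (negPf neq_pq) //.
by rewrite eh expoE oddx.
Qed.

(** Stripping letters of [p] from both ends of a word for [f] leaves a block with an odd number of
    letters of [q]. If there were at least three, substituting this block for [q] would give an
    endomorphism whose image over [p] and [q] contains [f] and [p], but not [q]. *)
Lemma free_pair_generator f : supported S f ->
    generated [set f; raag_gen e p] (raag_gen e q) ->
  exists s g1 g2, [/\ f = g1 * elt [:: (q, s)] * g2,
    supported (pred1 p) g1 & supported (pred1 p) g2].
Proof.
move=> Sf gen_q; have [w Sw [rw def_f]] := supported_reduced Sf.
have oddw : odd (count is_q w).
  by apply: (exponent_parity gen_q def_f (x := [:: (q, true)])); rewrite //= eqxx.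
have [w1 [w' [w2 [def_w q1 q2 hw']]]] := q_core_word w.
have oddw' : odd (count is_q w').
  by move: oddw; rewrite def_w !count_cat (count_is_q0 q1) (count_is_q0 q2) addn0.
have /and3P[Sw1 Sw' Sw2] : [&& over w1, over w' & over w2].
  by rewrite -!all_cat -def_w.
have p1 := pair_word_p Sw1 q1; have p2 := pair_word_p Sw2 q2.
have bw' : q_block w'.
  case: hw' => [w'0|/andP[hw' lw']]; first by rewrite w'0 in oddw'.
  apply/and4P; split=> //; move: rw; rewrite def_w.
  by move/reduced_catr/reduced_catl.
case: (leqP (count is_q w') 1) => [cnt|cnt].
  have [s def_w'] := q_block_count bw' cnt; exists s, (elt w1), (elt w2).
  by split; [rewrite def_f def_w !elt_cat def_w' mulgA|exists w1|exists w2].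
exfalso; have big_w' : (2 < count is_q w')%N.
  by move: cnt oddw'; case: (count _ w') => [|[|[|n]]].
have [|Phi PhiM Phi_gen] := @raag_lift _ e (raag e)
    (fun v => if v == p then raag_gen e p else if v == q then elt w' else 1).
  move=> u v euv; case: eqP => [up|_]; last first.
    case: eqP => [uq|_]; last by apply: commute_sym; apply: commute1.
    case: eqP => [vp|_]; first by move: euv nadj_pq; rewrite uq vp e_sym => ->.
    by case: ifP => _; [apply: commute_refl|apply: commute1].
  case: eqP => [vp|_]; first exact: commute_refl.
  case: eqP => [vq|_]; last exact: commute1.
  by move: euv nadj_pq; rewrite up vq => ->.
have Phi_p : Phi (raag_gen e p) = raag_gen e p by rewrite Phi_gen eqxx.
have Phi_q : Phi (raag_gen e q) = elt w'.
  by rewrite Phi_gen eq_sym (negPf neq_pq) eqxx.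
have Phi_pw x : all (fun l => pred1 p l.1) x -> Phi (elt x) = elt x.
  elim: x => [|[v s] x IH] /=; first by rewrite elt_nil morph1.
  move=> /andP[/eqP -> /IH ex]; rewrite elt_cons PhiM ex.
  by rewrite substitution_letter_p.
pose P := [set g | exists2 h, supported S h & g = Phi h].
have Pp g : supported S g -> P (Phi g) by exists g.
(* Since [f] is the image of [w1 q w2], the subgroup generated by [f] and [p] lies in the image of
   [Phi]. *)
have [h Sh def_q] : P (raag_gen e q).
  apply: (generated_ind (P := P)) gen_q.
    split; first by exists 1; [exact: supported1|rewrite morph1].
      move=> _ _ [g Sg ->] [h Sh ->].
      by exists (g * h); [exact: supportedM|rewrite PhiM].
    move=> _ [g Sg ->].
    by exists g^-1; [exact: supportedV|rewrite morphV].
  have Sp : S p by rewrite /S /= eqxx.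
  have Sq : S q by rewrite /S /= eqxx orbT.
  move=> _ [->|->]; last first.
    by rewrite -Phi_p; apply: Pp; apply: supported_gen.
  rewrite def_f def_w !elt_cat -Phi_q -(Phi_pw w1) // -(Phi_pw w2) // -!PhiM.
  apply: Pp; apply: supportedM; first by exists w1.
  by apply: supportedM; [apply: supported_gen|exists w2].
have [x Sx [rx def_h]] := supported_reduced Sh.
have [y [Sy ry ey _ cy]] :=
  substitution_reduced bw' oddw' big_w' PhiM Phi_p Phi_q Sx rx.
have unique z : over z -> reduced z -> elt z = raag_gen e q -> z = [:: (q, true)].
  move=> Sz rz ez; apply: column_inj => //; first by rewrite /S /= eqxx orbT.
  by move=> v _; apply: (reduced_column e_sym e_irr).
have y1 : y = [:: (q, true)] by apply: unique; rewrite // ey -def_h.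
(* A preimage of [q] that involves [q] would have at least three letters of [q] in its image; one
   that does not is fixed by [Phi], hence would equal [q]. *)
case: (boolP (has is_q x)) => [/cy|nqx]; first by rewrite y1 /= eqxx.
have px : all (fun l => pred1 p l.1) x by apply: pair_word_p; rewrite // all_predC.
have x1 : x = [:: (q, true)] by apply: unique; rewrite // -(Phi_pw x px) -def_h.
by move: nqx; rewrite x1 /= eqxx.
Qed.

End FreePair.

(** * Ears *)

Section Ears.
Variables (V : finType) (e : rel V).
Hypotheses (e_ear : is_ear e).

(** Eliminates the modulus, so that adjacency in a cycle becomes linear arithmetic. *)
Lemma modnS_cycle n i : i < n -> i.+1 %% n = if i.+1 == n then 0 else i.+1.
Proof.
case: eqP => [->|ne] lt_in; first by rewrite modnn.
by rewrite modn_small //; lia.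
Qed.

Lemma ear_degree_le2 v a b c : a != b -> e v a -> e v b -> e v c ->
  c = a \/ c = b.
Proof.
case: e_ear => -[n n_gt [f /bij_inj f_inj fe]]; rewrite -!fe.
all: move=> ab va vb vc; have {}ab : f a != f b by rewrite (inj_eq f_inj).
all: suff : (f c == f a) || (f c == f b) by rewrite !(inj_eq f_inj) => /orP[] /eqP; auto.
all: move: ab va vb vc; rewrite -!val_eqE /=.
all: have := ltn_ord (f a); have := ltn_ord (f b).
all: have := ltn_ord (f c); have := ltn_ord (f v).
  rewrite /path_graph.
  by move: (f a : nat) (f b : nat) (f c : nat) (f v : nat) => {c} a1 b1 c v1; clear; lia.
move=> hv hc hb ha; rewrite /cycle_graph !modnS_cycle //; move: hv hc hb ha n_gt.
move: (f a : nat) (f b : nat) (f c : nat) (f v : nat) => {c} a1 b1 c v1; clear.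
by case: (v1.+1 =P n); case: (a1.+1 =P n); case: (b1.+1 =P n);
  case: (c.+1 =P n); lia.
Qed.

Lemma ear_neighbour v : exists u, e v u.
Proof.
case: e_ear => -[n n_gt [f [f' fK f'K] fe]].
  case: (ltnP (f v).+1 n) => h.
    by exists (f' (Ordinal h)); rewrite -fe f'K /path_graph /= eqxx.
  have h' : (f v).-1 < n by have := ltn_ord (f v); lia.
  exists (f' (Ordinal h')); rewrite -fe f'K /path_graph /=.
  by apply/orP; right; apply/eqP; have := ltn_ord (f v); lia.
have h : (f v).+1 %% n < n by rewrite ltn_mod; lia.
by exists (f' (Ordinal h)); rewrite -fe f'K /cycle_graph /= eqxx.
Qed.

Hypothesis e_not_C4 : ~ graph_iso e (@cycle_graph 4).

(** Among paths and cycles, only the 4-cycle has two vertices with two common neighbours. *)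
Lemma ear_no_square a b u v : a != b -> ~~ e a b ->
  e u a -> e u b -> e v a -> e v b -> u = v.
Proof.
move=> + _; case: e_ear => -[n n_gt [f f_bij fe]]; have f_inj := bij_inj f_bij.
all: rewrite -!fe => ab ua ub va vb; have {ab} : f a != f b by rewrite (inj_eq f_inj).
all: apply: contraPeq; rewrite -(inj_eq f_inj) => uv ab.
all: move: uv ab ua ub va vb; rewrite -!val_eqE /=.
all: have := ltn_ord (f a); have := ltn_ord (f b).
all: have := ltn_ord (f u); have := ltn_ord (f v).
  rewrite /path_graph.
  by move: (f a : nat) (f b : nat) (f u : nat) (f v : nat) => a1 b1 u1 v1; clear; lia.
have [n4|n4] := eqVneq n 4.
  by case: e_not_C4; subst n; exists f.
move=> hv hu hb ha; rewrite /cycle_graph !modnS_cycle //; move: hv hu hb ha n_gt n4.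
move: (f a : nat) (f b : nat) (f u : nat) (f v : nat) => a1 b1 u1 v1; clear.
by case: (v1.+1 =P n); case: (a1.+1 =P n); case: (b1.+1 =P n);
  case: (u1.+1 =P n); lia.
Qed.

End Ears.

(** * Automorphisms and the proof of the lemma *)

Section RaagMorphisms.
Local Open Scope group_scope.
Variables (V : finType) (e : rel V).
Hypotheses (e_sym : symmetric e) (e_irr : irreflexive e).
Local Notation elt := (elt e).
Implicit Types (S : pred V) (g h x y z : raag e).

Lemma elt_letterE v s :
  elt [:: (v, s)] = if s then raag_gen e v else (raag_gen e v)^-1.
Proof. by case: s => //; rewrite -[(v, false)]/(letter_inv (v, true)) elt_letterV. Qed.

Lemma morph_letter (K : groupType) (phi : raag e -> K) v s :
  {morph phi : g h / g * h} ->
  phi (elt [:: (v, s)]) = if s then phi (raag_gen e v) else (phi (raag_gen e v))^-1.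
Proof. by move=> phiM; rewrite elt_letterE; case: s; rewrite ?(morphV phiM). Qed.

Lemma morph_supported_eq (K : groupType) (phi psi : raag e -> K) S g :
    {morph phi : g h / g * h} ->
    {morph psi : g h / g * h} ->
    (forall v, S v -> phi (raag_gen e v) = psi (raag_gen e v)) ->
  supported S g -> phi g = psi g.
Proof.
move=> phiM psiM eqS [w Sw ->].
elim: w Sw => [|[v s] w IH] /=; first by rewrite elt_nil (morph1 phiM) (morph1 psiM).
by move=> /andP[/eqS ev /IH ew]; rewrite elt_cons phiM psiM ew
  (morph_letter _ _ phiM) (morph_letter _ _ psiM) ev.
Qed.

Lemma morph_supported (phi : raag e -> raag e) S g : {morph phi : g h / g * h} ->
  (forall v, supported S (phi (raag_gen e v))) -> supported S (phi g).
Proof.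
move=> phiM phiS; have [w ->] := elt_surj g.
elim: w => [|[v s] w IH]; first by rewrite elt_nil (morph1 phiM); apply: supported1.
rewrite elt_cons phiM; apply: supportedM => //; rewrite (morph_letter _ _ phiM).
by case: s => //; apply: supportedV.
Qed.

Lemma morph_generated (G K : groupType) (phi : G -> K) (A : set G) (T : set K) (g : G) :
    {morph phi : a b / a * b} -> is_subgroup T -> (forall a, A a -> T (phi a)) ->
  generated A g -> T (phi g).
Proof.
move=> phiM [T1 TM TV] AT.
apply: (generated_ind (P := [set a | T (phi a)])) => //.
by split=> [|a b Ta Tb|a Ta] /=; rewrite ?morph1 ?phiM ?morphV //; auto.
Qed.

Lemma commute_letter v s g :
  commute (elt [:: (v, s)]) g <-> commute (raag_gen e v) g.
Proof.
rewrite elt_letterE; case: s => //; split=> /commute_sym/commuteV c.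
  by apply: commute_sym; rewrite -[raag_gen e v]invgK.
exact: commute_sym.
Qed.

(** The values on generators of the retraction onto the subgroup over [S]. *)
Definition restrict S v := if S v then raag_gen e v else 1.

Lemma restrict_comm S u v : e u v -> commute (restrict S u) (restrict S v).
Proof.
rewrite /restrict => euv; case: ifP => _; last exact/commute_sym/commute1.
by case: ifP => _; [apply: raag_gen_comm|apply: commute1].
Qed.

Hypothesis no_square : forall a b u v,
  a != b -> ~~ e a b -> e u a -> e u b -> e v a -> e v b -> u = v.

Definition forked v := exists a b, [/\ e v a, e v b, a != b & ~~ e a b].

(* After a conjugation, [y] is a letter of a vertex [v], so that [z] lies in the
   subgroup generated by the star of [v]. Retracting onto this subgroup shows
   that [z] is already conjugate to a letter by an element commuting with [y]. *)
Lemma adjacent_pearls_letters y z :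
    inner_pearl y -> inner_pearl z -> adjacent_pearls y z ->
  exists c l m, [/\ y = elt [:: l] ^ c, z = elt [:: m] ^ c, e l.1 m.1,
    forked l.1 & forked m.1].
Proof.
move=> py pz [yz [t0 [yt0 zt0]]].
have [c [l [a [b [def_y la lb ab nab]]]]] :=
  inner_pearl_letter e_sym e_irr no_square py.
have [d [m [a' [b' [def_z ma mb ab' nab']]]]] :=
  inner_pearl_letter e_sym e_irr no_square pz.
have {}yz : commute y z by apply/commgP/eqP.
pose star v := (v == l.1) || e l.1 v.
have star_comm g : supported star g -> commute (elt [:: l]) g.
  case=> w Sw ->; elim: w Sw => [|k w IH] /=; first by move=> _; apply: commute1.
  move=> /andP[Sk Sw]; rewrite (elt_cons _ k); apply: commuteM; last exact: IH.
  case/orP: Sk => [/eqP kl|]; last exact: elt_letter_comm.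
  apply: (@supported_clique_abelian _ e (pred1 l.1)) => //.
  - by move=> u v /eqP -> /eqP ->; rewrite eqxx.
  - by exists [:: l]; rewrite //= eqxx.
  - by exists [:: k]; rewrite //= kl eqxx.
set z' := z ^ c^-1; have lz' : commute (elt [:: l]) z'.
  by apply: commuteJE; rewrite -def_y.
have [h1 [h2 [def_z' Sh1 Sh2]]] := centralizer_letter e_sym e_irr lz'.
have Sz' : supported star z'.
  rewrite def_z'; apply: supportedM; [move: Sh1|move: Sh2]; apply: supported_sub.
    by move=> v /eqP ->; rewrite /star eqxx.
  by move=> v; rewrite /star => ->; rewrite orbT.
have [rho rhoM rho_gen] := raag_lift (@restrict_comm star).
have rho_z' : rho z' = z'.
  apply: (morph_supported_eq (psi := id)) Sz' => // v Sv.
  by rewrite rho_gen /restrict Sv.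
have Srho g : supported star (rho g).
  apply: morph_supported => // v; rewrite rho_gen /restrict.
  by case: ifP => Sv; [apply: supported_gen|apply: supported1].
set k := rho (d * c^-1).
have z'E : z' = rho (elt [:: m]) ^ k by rewrite -rho_z' /z' def_z -conjgM morphJ.
case: m def_z z'E ma mb => w t def_z z'E ma mb.
(* Otherwise [rho] would kill the letter [m], and [z] would be trivial. *)
have Sw : star w.
  case: pz => z1 _ _; apply: contrapT => /negP Sw; case: z1.
  apply: (@conjg_inj _ c^-1); rewrite conj1g -/z' z'E (morph_letter _ _ rhoM) rho_gen.
  by rewrite /restrict (negPf Sw) invg1 if_same conj1g.
have rho_w : rho (elt [:: (w, t)]) = elt [:: (w, t)].
  apply: (morph_supported_eq (S := star) (psi := id)) => //.
    by move=> v Sv; rewrite rho_gen /restrict Sv.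
  by exists [:: (w, t)]; rewrite //= Sw.
rewrite rho_w in z'E.
(* If [w] were the vertex of [l], then [z'] would be a letter of that vertex, and [t0] would commute
   with [z] as it does with [y]. *)
case/orP: (Sw) => [/eqP wl|lw].
  exfalso; apply: zt0; apply/eqP/commgP.
  have def_l : l = (w, l.2) by rewrite wl -surjective_pairing.
  have : commute z' (t0 ^ c^-1).
    have -> : z' = elt [:: (w, t)].
      rewrite z'E; apply/conjg_fixP/commgP/commute_letter.
      by have := star_comm _ (Srho (d * c^-1)); rewrite def_l => /commute_letter.
    apply/commute_letter/(commute_letter _ l.2); rewrite -def_l.
    by apply: commuteJE; rewrite -def_y; apply/commgP/eqP.
  by move/(commuteJ c); rewrite !conjgKV.
(* The factor [k1] commutes with the letter of [w], and [k2] with [l]; so conjugation by [k2 * c]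
   serves both pearls. *)
have [k1 [k2 [def_k Sk1 Sk2]]] :=
  centralizer_letter e_sym e_irr (star_comm _ (Srho (d * c^-1))).
rewrite -/k in def_k.
exists (k2 * c), l, (w, t); split=> //; [| |by exists a, b|by exists a', b'].
  rewrite def_y conjgM; congr (_ ^ c); apply/esym/conjg_fixP/commgP.
  apply: star_comm; apply: supported_sub Sk2 => v.
  by rewrite /star => ->; rewrite orbT.
have -> : z = z' ^ c by rewrite /z' conjgKV.
rewrite conjgM; congr (_ ^ c); rewrite z'E def_k conjgM; congr (_ ^ k2).
apply/conjg_fixP/commgP.
case: Sk1 => w1 Sw1 ->; apply: elt_word_comm.
by apply: sub_all Sw1 => u /eqP ->; rewrite e_sym.
Qed.

End RaagMorphisms.

(** * Elementary automorphisms and vertex bases *)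

Section VertexBases.
Local Open Scope group_scope.
Variables (V : finType) (e : rel V).
Hypotheses (e_sym : symmetric e) (e_irr : irreflexive e).
Local Notation elt := (elt e).
Implicit Types (S : pred V) (g h x y z : raag e).

(** Killing a conjugate of [l] is the same as killing its vertex, so the quotient has the properties
    required by [pendant_of_splitting]. *)
Lemma pendant_of_split_quotient l (c : raag e) :
    splits_off_Z (quot [set elt [:: l] ^ c]) ->
  exists2 u, u != l.1 & forall u', e u u' -> u' = l.1.
Proof.
set y := elt [:: l] ^ c; have prM := @quot_proj_morph (raag e) [set y].
pose pr u := quot_proj [set y] (raag_gen e u).
apply: (@pendant_of_splitting V e l.1 (quot [set y]) pr) => //.
- move=> P P1 Pg PV g; rewrite -(quot_projK g).
  apply: (@presented_ind V (raag_relators e) (fun g => P (quot_proj [set y] g))).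
  + exact: P1.
  + by move=> u h Ph; rewrite prM; apply: Pg.
  + by move=> u h Ph; rewrite prM (morphV prM); apply: PV.
- by move=> u u' euu'; apply: (morph_commute prM); apply: raag_gen_comm.
- have : quot_proj [set y] y = 1 by apply: quot_relator.
  rewrite (morphJ prM) => /eqP; rewrite conjg_eq1 => /eqP.
  case: (l) => v [] //=; rewrite (morph_letter _ _ prM) => /eqP.
  by rewrite invg_eq1 => /eqP.
move=> K f fC fv; have [phi phiM phi_gen] := raag_lift fC.
have [|psi psiM psiE] := @quot_lift _ _ [set y] _ phiM.
  move=> _ ->; rewrite /y (morphJ phiM); case: (l) fv => v s /= fv.
  by rewrite (morph_letter _ _ phiM) phi_gen fv invg1 if_same conj1g.
by exists psi => // u; rewrite psiE.
Qed.

Lemma vertex_basis_morph (phi psi : raag e -> raag e) :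
    {morph phi : g h / g * h} -> cancel phi psi -> cancel psi phi ->
  vertex_basis (fun v => phi (raag_gen e v)).
Proof.
move=> phiM phiK psiK.
pose F : {multiplicative raag e -> raag e} :=
  HB.pack phi (isMultiplicative.Build _ _ phi phiM).
by exists F => //; exists psi.
Qed.

Lemma inversion_automorphism (s : V -> bool) : exists phi,
  [/\ {morph phi : g h / g * h}, involutive phi &
      forall v, phi (raag_gen e v) = elt [:: (v, s v)]].
Proof.
have [|phi phiM phi_gen] := @raag_lift _ e (raag e) (fun v => elt [:: (v, s v)]).
  by move=> u v euv; apply: elt_letter_comm.
exists phi; split=> //; apply: presented_ext => [g h|//|v].
- by rewrite /= !phiM.
have : phi (phi (raag_gen e v)) = raag_gen e v.
  rewrite phi_gen (morph_letter _ _ phiM) phi_gen; case: (s v) => //.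
  by rewrite -[(v, false)]/(letter_inv (v, true)) elt_letterV invgK.
by [].
Qed.

Lemma supported_fixed S (phi : raag e -> raag e) g : {morph phi : g h / g * h} ->
  (forall v, S v -> phi (raag_gen e v) = raag_gen e v) -> supported S g -> phi g = g.
Proof. by move=> phiM; apply: (morph_supported_eq phiM (psi := id)). Qed.

(** The condition on [S] makes every neighbour of [b] commute with [g1] and [g2], so that the
    relations at [b] are preserved. *)
Lemma transvection (S : pred V) b g1 g2 : ~~ S b ->
    (forall u v, e b u -> S v -> v != u -> e u v) -> 
    supported S g1 -> supported S g2 ->
  exists phi, [/\ {morph phi : g h / g * h}, phi (raag_gen e b) = g1 * raag_gen e b * g2 &
      forall v, v != b -> phi (raag_gen e v) = raag_gen e v].
Proof.
move=> Sb eS Sg1 Sg2.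
have comm_g u g : e b u -> supported S g -> commute (raag_gen e u) g.
  move=> ebu [w Sw ->]; elim: w Sw => [_|[v s] w IH] /=; first exact: commute1.
  move=> /andP[Sv /IH c]; rewrite elt_cons; apply: commuteM => //.
  have cv : commute (raag_gen e u) (raag_gen e v).
    case: (eqVneq v u) => [->|nvu]; first exact: commute_refl.
    by apply: raag_gen_comm; apply: eS.
  case: s => //; rewrite -[(v, false)]/(letter_inv (v, true)) elt_letterV.
  exact: commuteV.
have [|phi phiM phi_gen] := @raag_lift _ e (raag e)
    (fun v => if v == b then g1 * raag_gen e b * g2 else raag_gen e v).
  have comm_b u : e b u -> commute (raag_gen e u) (g1 * raag_gen e b * g2).
    move=> ebu; apply: commuteM; last exact: comm_g.
    apply: commuteM; first exact: comm_g.
    by apply: raag_gen_comm; rewrite e_sym.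
  move=> u v euv; case: eqP => [ub|_]; case: eqP => [vb|_].
  - exact: commute_refl.
  - by apply: commute_sym; apply: comm_b; rewrite -ub.
  - by apply: comm_b; rewrite -vb e_sym.
  - exact: raag_gen_comm.
exists phi; split=> // [|v vb]; first by rewrite phi_gen eqxx.
by rewrite phi_gen (negPf vb).
Qed.

(** Both maps fix the elements over [S], so the transvection by [g1^-1] and [g2^-1] is the
    inverse. *)
Lemma transvection_automorphism (S : pred V) b g1 g2 : ~~ S b ->
    (forall u v, e b u -> S v -> v != u -> e u v) -> 
    supported S g1 -> supported S g2 ->
  exists phi psi, [/\ {morph phi : g h / g * h}, cancel phi psi, cancel psi phi,
      phi (raag_gen e b) = g1 * raag_gen e b * g2 &
      forall v, v != b -> phi (raag_gen e v) = raag_gen e v].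
Proof.
move=> Sb eS Sg1 Sg2.
have [phi [phiM phi_b phi_v]] := transvection Sb eS Sg1 Sg2.
have [psi [psiM psi_b psi_v]] :=
  transvection Sb eS (supportedV Sg1) (supportedV Sg2).
have neq_b v : S v -> v != b by move=> Sv; apply: contraTneq Sv => ->.
have phi_S g : supported S g -> phi g = g.
  by apply: supported_fixed => // v /neq_b; apply: phi_v.
have psi_S g : supported S g -> psi g = g.
  by apply: supported_fixed => // v /neq_b; apply: psi_v.
exists phi, psi; split=> //.
- apply: (@presented_ext _ _ _ (psi \o phi) id) => [g h|//|v] /=.
    by rewrite phiM psiM.
  rewrite -[presented_gen _ _]/(raag_gen e v).
  case: (eqVneq v b) => [->|nvb]; last by rewrite phi_v // psi_v.
  by rewrite phi_b !psiM (psi_S _ Sg1) (psi_S _ Sg2) psi_b !mulgA mulgV mul1g mulgVK.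
apply: (@presented_ext _ _ _ (phi \o psi) id) => [g h|//|v] /=.
  by rewrite psiM phiM.
rewrite -[presented_gen _ _]/(raag_gen e v).
case: (eqVneq v b) => [->|nvb]; last by rewrite psi_v // phi_v.
rewrite psi_b !phiM (phi_S _ (supportedV Sg1)) (phi_S _ (supportedV Sg2)) phi_b.
by rewrite !mulgA mulVg mul1g mulgK.
Qed.

(** The basis is obtained by inverting generators, then applying a transvection of [b], then
    conjugating by [c]. The only neighbour of [b] is [v], which commutes with [w]. *)
Lemma vertex_basis_exists v w b s t r (c h1 h2 : raag e) :
    e v w -> e v b -> w != b -> (forall u, e b u -> u = v) ->
    supported (pred2 v w) h1 -> supported (pred2 v w) h2 ->
  exists f : V -> raag e, vertex_basis f /\
    [/\ f b = (h1 * elt [:: (b, r)] * h2) ^ c,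
        f v = elt [:: (v, s)] ^ c & f w = elt [:: (w, t)] ^ c].
Proof.
move=> evw evb wb b_pendant S1 S2.
have vw : v != w by apply: contraTneq evw => ->; rewrite e_irr.
have vb : v != b by apply: contraTneq evb => ->; rewrite e_irr.
have [sg [sgM sgK sg_gen]] := inversion_automorphism
  (fun u => if u == v then s else if u == w then t else r).
have Sb : ~~ pred2 v w b by rewrite /= negb_or eq_sym vb eq_sym wb.
have eS u u' : e b u -> pred2 v w u' -> u' != u -> e u u'.
  by move=> /b_pendant -> /pred2P[] -> //; rewrite eqxx.
have [phi [psi [phiM phiK psiK phi_b phi_v]]] :
    exists phi psi, [/\ {morph phi : g h / g * h}, cancel phi psi, cancel psi phi,
      phi (elt [:: (b, r)]) = h1 * elt [:: (b, r)] * h2 &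
      forall v, v != b -> phi (raag_gen e v) = raag_gen e v].
  (* For the inverse letter, [b] is sent to [h2^-1 * b * h1^-1], whose inverse is the required
     element. *)
  case: r {sg_gen}; first exact: (transvection_automorphism Sb eS S1 S2).
  have [phi [psi [phiM phiK psiK phi_b phi_v]]] :=
    transvection_automorphism Sb eS (supportedV S2) (supportedV S1).
  exists phi, psi; split=> //; rewrite (morph_letter _ _ phiM) phi_b.
  by rewrite elt_letterE !invgM !invgK mulgA.
exists (fun u => phi (sg (raag_gen e u)) ^ c); split.
  apply: (@vertex_basis_morph (fun g => phi (sg g) ^ c)
    (fun g => sg (psi (g ^ c^-1)))).
  - by move=> g h; rewrite sgM phiM conjMg.
  - by move=> g; rewrite conjgK phiK sgK.
  - by move=> g; rewrite sgK psiK conjgKV.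
rewrite !sg_gen eqxx !(eq_sym _ v) (negPf vw) (negPf vb) eqxx (eq_sym _ w) (negPf wb).
split; first by rewrite phi_b.
  by rewrite (morph_letter _ _ phiM) phi_v // -elt_letterE.
by rewrite (morph_letter _ _ phiM) phi_v // -elt_letterE.
Qed.

End VertexBases.

Theorem lemma3p2 (V : finType) (e : rel V)
  (e_sym : symmetric e) (e_irr : irreflexive e)
  (e_ear : is_ear e) (e_not_C4 : ~ graph_iso e (@cycle_graph 4))
  (x y z : raag e)
  (y_pearl : inner_pearl y) (z_pearl : inner_pearl z)
  (yz_adj : adjacent_pearls y z)
  (Cy : centralizer y = generated [set x; y; z])
  (y_split : splits_off_Z (quot [set y])) :
  exists b : V -> raag e, vertex_basis b /\
    exists u v w : V,
      [/\ b u = x, b v = y & b w = z] /\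
      [/\ degree e u = 1, e u v, degree e w = 2 & e v w].
Proof.
have no_square := @ear_no_square V e e_ear e_not_C4.
have nbrs := @ear_degree_le2 V e e_ear.
have [c [[v s] [[w t] [def_y def_z /= evw
    [a [a' [va va' aa' naa']]] [d [d' [wd wd' dd' _]]]]]]] :=
  adjacent_pearls_letters e_sym e_irr no_square y_pearl z_pearl yz_adj.
(* As [v] has at most two neighbours and is forked, [w] is one of [a] and [a'], and [b] is the
   other. *)
have [b [evb wb nwb]] : exists b, [/\ e v b, w != b & ~~ e w b].
  case: (nbrs v a a' w aa' va va' evw) => ->; first by exists a'.
  by exists a; split=> //; [rewrite eq_sym|rewrite e_sym].
have [u uv u_pendant] : exists2 u, u != v & forall u', e u u' -> u' = v.
  by apply: (@pendant_of_split_quotient V e e_irr (v, s) c); rewrite -def_y.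
have euv : e v u by have [u' euu'] := ear_neighbour e_ear u;
  rewrite e_sym -(u_pendant _ euu').
(* The pendant vertex [u] is a neighbour of [v]; it is not [w], which has two neighbours, so it is
   [b]. *)
have {u uv u_pendant euv} b_pendant u' : e b u' -> u' = v.
  case: (nbrs v w b u wb evw evb euv) u_pendant => [->|-> ub /ub //].
  by move=> w_pendant; case/eqP: dd'; rewrite (w_pendant d wd) (w_pendant d' wd').
set L := [set x; y; z]%classic in Cy.
set x0 := (x ^ c^-1)%g.
have Cv g : commute (raag_gen e v) g -> generated L (g ^ c)%g.
  move=> vg; rewrite -Cy /centralizer /= def_y; apply: commuteJ.
  exact/commute_letter.
have vx0 : commute (elt e [:: (v, s)]) x0.
  apply: commuteJE; rewrite -def_y -[commute _ _]/(centralizer y x) Cy.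
  by apply: generated_sub; left; left.
have [h1 [h2 [def_x0 Sh1 Sh2]]] := centralizer_letter e_sym e_irr vx0.
have {}Sh2 : supported (pred2 w b) h2.
  apply: supported_sub Sh2 => u /= evu; apply/pred2P.
  exact: nbrs wb evw evb evu.
have neq_v u : e v u -> u == v = false.
  by move=> evu; apply/negbTE; apply: contraTneq evu => ->; rewrite e_irr.
(* [kappa] kills [v]. After undoing the conjugation it sends [x] to [h2], [y] to 1 and [z] to a
   letter of [w], so generation of the centralizer yields generation of [b]. *)
have [kappa kappaM kappa_gen] := raag_lift (@restrict_comm V e (predC1 v)).
have kappa_v : kappa (raag_gen e v) = 1%g.
  by rewrite kappa_gen /restrict /= eqxx.
have kappa_nbr u : e v u -> kappa (raag_gen e u) = raag_gen e u.
  by move=> /neq_v nuv; rewrite kappa_gen /restrict /= nuv.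
have gen_b : generated [set h2; raag_gen e w] (raag_gen e b).
  pose theta g := kappa (g ^ c^-1)%g.
  have thetaM : {morph theta : g h / (g * h)%g}.
    by move=> g h; rewrite /theta conjMg kappaM.
  rewrite -(kappa_nbr b evb) -[raag_gen e b](conjgK c) -/(theta _).
  apply: (morph_generated thetaM (generated_subgroup _)) (Cv _ _); last first.
    exact: raag_gen_comm.
  have [G1 GM GV] := generated_subgroup [set h2; raag_gen e w].
  move=> _ [[->|->]|->]; rewrite /theta.
  - rewrite -/x0 def_x0 kappaM.
    have -> : kappa h1 = 1%g.
      apply: (morph_supported_eq kappaM (psi := fun=> 1%g)) Sh1 => [g h|u /eqP ->//].
      by rewrite mulg1.
    rewrite mul1g (supported_fixed kappaM _ Sh2); first by apply: generated_sub; left.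
    by move=> u /pred2P[] ->; apply: kappa_nbr.
  - by rewrite def_y conjgK (morph_letter _ _ kappaM) kappa_v invg1 if_same.
  rewrite def_z conjgK (morph_letter _ _ kappaM) kappa_nbr //.
  have Gw : generated [set h2; raag_gen e w] (raag_gen e w).
    by apply: generated_sub; right.
  by case: (t) => //; apply: GV.
have [r [g1 [g2 [def_h2 Sg1 Sg2]]]] :=
  free_pair_generator e_sym e_irr wb nwb Sh2 gen_b.
(* The power of [v] in [x0] is absorbed in the left factor [h1 * g1]. *)
have [||f [f_basis [fb fv fw]]] := @vertex_basis_exists V e e_sym e_irr v w b s t r c
  (h1 * g1)%g g2 evw evb wb b_pendant.
- apply: supportedM; [apply: supported_sub Sh1|apply: supported_sub Sg1] => u /eqP ->;
  by rewrite /= eqxx ?orbT.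
- by apply: supported_sub Sg2 => u /eqP ->; rewrite /= eqxx orbT.
exists f; split=> //; exists b, v, w; split; split=> //.
- rewrite fb -(conjgKV c x) -/x0 def_x0 def_h2 !mulgA //.
- by rewrite fv.
- by rewrite fw.
- rewrite /degree -(card1 v); apply: eq_card => u; rewrite !inE.
  apply/idP/eqP => [/b_pendant //|->]; by rewrite e_sym.
- by rewrite e_sym.
rewrite /degree; have : #|pred2 d d'| = 2 by rewrite card2 dd'.
move=> <-; apply: eq_card => u; rewrite !inE; apply/idP/pred2P.
  exact: nbrs dd' wd wd'.
by case=> ->.
Qed.
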